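(* Assume $\varepsilon>2M$. Let $\alpha_1\in\mathrm{UHP}_1$ be fixed, let $\phi_2\in(-\pi,0)$ and put $\alpha_2=|\alpha_2|e^{i\phi_2}$. Then, as $|\alpha_2|\to\infty$ (within $\mathrm{LHP}_2$), $$I_{+-}^{\varepsilon}(\alpha_1,\alpha_2)\sim\frac{\Lambda_2(\alpha_1,\varepsilon)}{\alpha_2^{3/2}},\qquad \Lambda_2(\alpha_1,\varepsilon)=\frac{\beta\sqrt{\pi}\,\Gamma(\nu)\,e^{-3i\frac{\pi}{4}}}{2\,\Gamma(\nu+3/2)}\times\frac{1}{(\varepsilon-i\alpha_1)^{\nu}},$$ i.e. the ratio of the two sides tends to $1$, where $\Gamma$ is the Euler Gamma function and $\alpha_2^{3/2}=|\alpha_2|^{3/2}e^{3i\phi_2/2}$.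
   Context: Contours and half-planes. For $j=1,2$, $\mathcal{A}_j$ is an integration contour in the complex $\alpha_j$-plane running from $-\infty$ to $+\infty$, which coincides with the real axis outside a bounded (indented) part. $\mathrm{UHP}_j$ denotes the set of points lying on and above $\mathcal{A}_j$, $\mathrm{LHP}_j$ the set of points lying on and below $\mathcal{A}_j$, and $\mathcal{D}_{+-}=\mathrm{UHP}_1\times\mathrm{LHP}_2$. The constant $M>0$ is such that $\operatorname{Im}\alpha_1\ge -M$ for all $\alpha_1\in\mathrm{UHP}_1$ and $\operatorname{Im}\alpha_2\le M$ for all $\alpha_2\in\mathrm{LHP}_2$. Eigenfunction and exponent. Let $\ell_1$ be the first (smallest) eigenvalue of (minus) the Laplace-Beltrami operator on the unit sphere, with spherical coordinates $(\theta,\varphi)$, with Dirichlet condition on the cut $\{\theta=\pi/2,\ \varphi\in[0,\pi/2]\}$; let $f(\theta,\varphi)$ be the associated first eigenfunction, and $\nu=\sqrt{\ell_1+1/4}\approx 0.7967$. The following properties of $f$ are taken as known: $f(\pi/2,\varphi)=0$ for $\varphi\in[0,\pi/2]$; $f(\pi/2,\cdot)$ is smooth with $0<f(\pi/2,\varphi)\le 1$ on $(\pi/2,2\pi)$; $f(\pi/2,\varphi)=\mathcal{O}(\sqrt{\varphi-\pi/2})$ as $\varphi\to\pi/2^+$ and $\mathcal{O}(\sqrt{2\pi-\varphi})$ as $\varphi\to 2\pi^-$; $f(\pi/2,\cdot)$ is strictly decreasing on $[3\pi/2,2\pi]$. Moreover $\beta$ is the (nonzero) constant such that $f(\pi/2,2\pi-\psi)\sim\beta\sqrt{\psi}$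 as $\psi\to0^+$. The integral. For $(\alpha_1,\alpha_2)\in\mathcal{D}_{+-}$, $$I_{+-}^{\varepsilon}(\alpha_1,\alpha_2)=\int_{\frac{3\pi}{2}}^{2\pi}\frac{f\left(\frac{\pi}{2},\varphi\right)}{\bigl(-i(\alpha_1\cos\varphi+\alpha_2\sin\varphi+i\varepsilon)\bigr)^{\nu+3/2}}\,d\varphi .$$ Complex powers of numbers with positive real part are principal values. *)

(* Defs.v *)
From Stdlib Require Import Reals.
From Coquelicot Require Import Coquelicot.

Open Scope R_scope.

(** * Complex exponential and principal powers; Euler's Gamma function *)

Definition Cexp (z : C) : C := (exp (Re z) * cos (Im z), exp (Re z) * sin (Im z)).

(* Principal argument, with values in (-PI, PI] (and 0 at 0). *)
Definition Carg (z : C) : R :=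
  let x := Re z in
  let y := Im z in
  if Rlt_dec 0 x then atan (y / x)
  else if Rlt_dec 0 y then PI / 2 - atan (x / y)
  else if Rlt_dec y 0 then - (PI / 2) - atan (x / y)
  else if Rlt_dec x 0 then PI else 0.

(* Principal value of z^s, for z <> 0 and a real exponent s. *)
Definition Cpow_principal (z : C) (s : R) : C :=
  Cexp (RtoC s * (ln (Cmod z), Carg z))%C.

Definition Cpolar (r phi : R) : C := (RtoC r * Cexp (Ci * RtoC phi))%C.

(* Meaningful for x > 0, where the improper integral converges. *)
Definition Gamma (x : R) : R :=
  RInt_gen (fun t => Rpower t (x - 1) * exp (- t))
    (at_right 0) (Rbar_locally p_infty).

(** * Contours and half-planes *)

(* The parametrization is normalized so that the parameter is the abscissa
   outside the bounded indented part. *)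
Record is_contour (A : R -> C) : Prop := {
  contour_continuous : forall t, continuous A t;
  contour_simple : forall s t, A s = A t -> s = t;
  contour_real_axis : exists T, forall t, T <= Rabs t -> A t = RtoC t
}.

(* A point off the contour lies above (below) it when it can be joined to
   infinity inside the complement of the contour by a path whose imaginary part
   tends to +oo (to -oo), i.e. when it belongs to the upper (lower) component of
   the complement. *)
Definition joined_off_contour (A : R -> C) (z : C) (l : Rbar) : Prop :=
  exists p : R -> C,
    (forall t, continuous p t) /\ p 0 = z /\
    (forall t s, 0 <= t -> p t <> A s) /\
    is_lim (fun t => Im (p t)) p_infty l.

Definition on_contour (A : R -> C) (z : C) : Prop := exists t, A t = z.

Definition UHP (A : R -> C) (z : C) : Prop :=
  on_contour A z \/ joined_off_contour A z p_infty.

Definition LHP (A : R -> C) (z : C) : Prop :=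
  on_contour A z \/ joined_off_contour A z m_infty.

(** * Dirichlet eigenfunctions on the sphere slit along a quarter of its equator *)

(* Functions on the sphere are written u theta phi, with polar angle
   theta in [0, PI] and azimuth phi in R. *)
Definition laplace_beltrami (u : R -> R -> R) (theta phi : R) : R :=
  / sin theta *
    Derive (fun t => sin t * Derive (fun s => u s phi) t) theta
  + / (sin theta)^2 * Derive_n (fun p => u theta p) 2 phi.

Definition on_cut (theta phi : R) : Prop :=
  theta = PI / 2 /\
  exists k : Z, 0 <= phi - 2 * PI * IZR k <= PI / 2.

(* The first three fields say that u is a continuous function on the whole
   sphere.  The equation is required away from the poles theta = 0, PI, where the
   spherical coordinates degenerate; since u is continuous there, these isolated
   points are removable singularities and impose no further condition.
   Continuity up to the cut selects the finite-energy eigenfunctions. *)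
Record dirichlet_eigenfunction (l : R) (u : R -> R -> R) : Prop := {
  eigen_periodic : forall theta phi, u theta (phi + 2 * PI) = u theta phi;
  eigen_poles : forall phi psi, u 0 phi = u 0 psi /\ u PI phi = u PI psi;
  eigen_continuous : forall theta phi, 0 <= theta <= PI ->
    filterlim (fun q : R * R => u (fst q) (snd q))
      (within (fun q : R * R => 0 <= fst q <= PI) (locally (theta, phi)))
      (locally (u theta phi));
  eigen_dirichlet : forall theta phi, on_cut theta phi -> u theta phi = 0;
  eigen_C2 : forall theta phi, 0 < theta < PI -> ~ on_cut theta phi ->
    ex_diff_n u 2 theta phi;
  eigen_equation : forall theta phi, 0 < theta < PI -> ~ on_cut theta phi ->
    - laplace_beltrami u theta phi = l * u theta phi;
  eigen_nonzero : exists theta phi, 0 <= theta <= PI /\ u theta phi <> 0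
}.

Definition first_eigenfunction (l1 : R) (f : R -> R -> R) : Prop :=
  dirichlet_eigenfunction l1 f /\
  forall l u, dirichlet_eigenfunction l u -> l1 <= l.

Record equatorial_properties (f : R -> R -> R) (beta : R) : Prop := {
  eq_zero : forall phi, 0 <= phi <= PI / 2 -> f (PI / 2) phi = 0;
  eq_smooth : forall n phi, PI / 2 < phi < 2 * PI -> ex_derive_n (f (PI / 2)) n phi;
  eq_bounds : forall phi, PI / 2 < phi < 2 * PI -> 0 < f (PI / 2) phi <= 1;
  eq_bigO_left : exists K,
    at_right (PI / 2) (fun phi => Rabs (f (PI / 2) phi) <= K * sqrt (phi - PI / 2));
  eq_bigO_right : exists K,
    at_left (2 * PI) (fun phi => Rabs (f (PI / 2) phi) <= K * sqrt (2 * PI - phi));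
  eq_decreasing : forall phi psi,
    3 * PI / 2 <= phi -> phi < psi -> psi <= 2 * PI ->
    f (PI / 2) psi < f (PI / 2) phi;
  eq_beta_neq0 : beta <> 0;
  eq_beta : filterlim (fun psi => f (PI / 2) (2 * PI - psi) / (beta * sqrt psi))
    (at_right 0) (locally 1)
}.

(** * The integral and its asymptotic coefficient *)

Definition nu_of (l1 : R) : R := sqrt (l1 + 1 / 4).

Definition I_pm (f : R -> R -> R) (nu eps : R) (alpha1 alpha2 : C) : C :=
  RInt (V := C_R_CompleteNormedModule)
    (fun phi : R =>
       (RtoC (f (PI / 2)%R phi) /
        Cpow_principal
          (- Ci * (alpha1 * RtoC (cos phi) + alpha2 * RtoC (sin phi)
                   + Ci * RtoC eps))
          (nu + 3 / 2)%R)%C)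
    (3 * PI / 2) (2 * PI).

Definition Lambda2 (beta nu : R) (alpha1 : C) (eps : R) : C :=
  (RtoC (beta * sqrt PI * Gamma nu)%R * Cexp (- (3 * Ci * RtoC (PI / 4)%R))
     / RtoC (2 * Gamma (nu + 3 / 2))%R
   * (1 / Cpow_principal (RtoC eps - Ci * alpha1) nu))%C.

(* Main.v *)
Require Import Defs.
From Stdlib Require Import Reals Lra Lia ZArith Classical IndefiniteDescription.
From Coquelicot Require Import Coquelicot.

Open Scope R_scope.

(** Put phi = 2 PI - psi and alpha2 = |alpha2| e^(i phi2), r = |alpha2|.  The base of
    the power in the integrand becomes
      z = eps - i alpha1 cos psi + r e^(i w) sin psi,    w = phi2 + PI/2,
    and |w| < PI/2, so that Re z has a positive lower bound and grows like r sin psi: the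
    integral concentrates on psi of order 1/r.  There z is close to a + e^(i w) u^2,
    with a = eps - i alpha1 and psi = u^2 / r, while f(PI/2, 2 PI - psi) is close to
    beta u r^(-1/2).  With s = nu + 3/2, therefore, r^(3/2) I tends to
      beta * (integral over u > 0 of 2 u^2 (a + e^(i w) u^2)^(-s) du).
    For fixed U the part u < U is a parametric integral that is continuous in
    r^(-1/2) up to the value 0 (RInt_param_limit, rescaled_integrand_continuous_2d),
    and the part u > U is O(U^(-2 nu)) uniformly in r (rescaled_tail);
    equatorial_integral_lim combines the two.

    Turning the direction e^(i w) to that of a does not change the limit integral
    times e^(3 i w / 2): this is Cauchy's theorem, proved in
    ray_integral_rotation by differentiating with respect to the angle.  Along the
    direction of a the integral scales to the Beta integral B(3/2, nu) times a
    power of a, and B(3/2, nu) Gamma(nu + 3/2) = Gamma(3/2) Gamma(nu)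
    (beta_integral_lim); the case nu = 3/2 is elementary and gives the value
    Gamma(3/2) = sqrt PI / 2 (Gamma_3_2).

    All of this requires nu > 0, that is l1 > -1/4.  A maximum principle on
    the slit sphere shows l1 >= 0 (eigenvalue_nonneg).

    Complex integrals are treated through the real functions Re (e^(i kappa) z^(-s)),
    written kernel s kappa, for kappa = 0 and kappa = -PI/2. *)

(** * A maximum principle on the slit sphere *)

(** A local property with a scale d holds on the whole rectangle with one scale, provided
    that it is inherited by smaller scales. *)
Lemma rectangle_uniform (a b a' b' : R) (Q : posreal -> R -> R -> Prop) :
  (forall (d e : posreal) x y, Q d x y -> e <= d -> Q e x y) ->
  (forall u v, a <= u <= b -> a' <= v <= b' -> exists d : posreal,
     forall x y, a <= x <= b -> a' <= y <= b' ->
       Rabs (x - u) < d -> Rabs (y - v) < d -> Q d x y) ->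
  exists d : posreal, forall x y, a <= x <= b -> a' <= y <= b' -> Q d x y.
Proof.
  intros Hmon Hloc.
  assert (Hch : forall p : R * R, exists d : posreal,
    a <= fst p <= b -> a' <= snd p <= b' ->
    forall x y, a <= x <= b -> a' <= y <= b' ->
       Rabs (x - fst p) < d -> Rabs (y - snd p) < d -> Q d x y).
  { intros [u v]; simpl.
    destruct (classic (a <= u <= b /\ a' <= v <= b')) as [[Hu Hv]|Hn].
    - destruct (Hloc u v Hu Hv) as [d Hd]; exists d; auto.
    - exists (mkposreal 1 Rlt_0_1); tauto. }
  destruct (functional_choice _ Hch) as [delta Hdelta].
  destruct (compactness_value_2d a b a' b' (fun u v => delta (u, v))) as [d Hd].
  exists d; intros x y Hx Hy.
  apply NNPP; intros Hn; apply (Hd x y Hx Hy); intros (u & v & Hu & Hv & H1 & H2 & H3).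
  apply Hn, (Hmon (delta (u, v))); [|exact H3].
  exact (Hdelta (u, v) Hu Hv x y Hx Hy H1 H2).
Qed.

Lemma posreal_min (d e : posreal) : exists m : posreal, m <= d /\ m <= e.
Proof.
  exists (mkposreal _ (Rmin_stable_in_posreal d e)); simpl.
  split; [apply Rmin_l | apply Rmin_r].
Qed.

(** D need not be closed: at points outside D the hypothesis asks for arbitrarily
    negative bounds of F on the nearby points of D. *)
Lemma rectangle_max (a b a' b' : R) (D : R -> R -> Prop) (F : R -> R -> R) (x0 y0 : R) :
  (forall x y, D x y -> a <= x <= b /\ a' <= y <= b') ->
  D x0 y0 ->
  (forall u v c, a <= u <= b -> a' <= v <= b' -> (D u v -> F u v < c) ->
     exists d : posreal, forall x y, D x y ->
       Rabs (x - u) < d -> Rabs (y - v) < d -> F x y < c) ->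
  exists u v, D u v /\ forall x y, D x y -> F x y <= F u v.
Proof.
  intros HD H0 Husc.
  assert (Hbd : exists K, forall x y, D x y -> F x y <= K).
  { destruct (rectangle_uniform a b a' b' (fun d x y => D x y -> F x y <= / d)) as [d Hd].
    - intros d e x y H He Hxy; apply Rle_trans with (1 := H Hxy).
      apply Rinv_le_contravar; [apply cond_pos | exact He].
    - intros u v Hu Hv.
      destruct (Husc u v (Rabs (F u v) + 1) Hu Hv) as [d Hd].
      { intros _; generalize (Rle_abs (F u v)); lra. }
      assert (Hp : 0 < / (Rabs (F u v) + 1)).
      { apply Rinv_0_lt_compat; generalize (Rabs_pos (F u v)); lra. }
      destruct (posreal_min d (mkposreal _ Hp)) as [m [Hm1 Hm2]]; simpl in Hm2.
      exists m; intros x y _ _ H1 H2 Hxy.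
      apply Rlt_le, Rlt_le_trans with (Rabs (F u v) + 1).
      { apply Hd; [exact Hxy | lra | lra]. }
      rewrite <- (Rinv_inv (Rabs (F u v) + 1)).
      apply Rinv_le_contravar; [apply cond_pos | exact Hm2].
    - exists (/ d); intros x y Hxy; destruct (HD x y Hxy) as [Hx Hy]; auto. }
  destruct Hbd as [K HK].
  destruct (completeness (fun z => exists x y, D x y /\ z = F x y)) as [S [HS1 HS2]].
  { exists K; intros z (x & y & Hxy & ->); auto. }
  { exists (F x0 y0), x0, y0; auto. }
  assert (HS : forall x y, D x y -> F x y <= S).
  { intros x y Hxy; apply HS1; exists x, y; auto. }
  apply NNPP; intros Hno.
  assert (Hlt : forall u v, D u v -> F u v < S).
  { intros u v Huv; destruct (Rlt_dec (F u v) S) as [H|H]; [exact H|].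
    exfalso; apply Hno; exists u, v; split; [exact Huv|].
    intros x y Hxy; generalize (HS x y Hxy); lra. }
  destruct (rectangle_uniform a b a' b' (fun d x y => D x y -> F x y <= S - d)) as [d Hd].
  - intros d e x y H He Hxy; generalize (H Hxy); lra.
  - intros u v Hu Hv.
    assert (Hc : exists c : posreal, D u v -> F u v < S - c).
    { destruct (classic (D u v)) as [Huv|Hn].
      - assert (Hp : 0 < (S - F u v) / 2) by (generalize (Hlt u v Huv); lra).
        exists (mkposreal _ Hp); simpl; intros _; lra.
      - exists (mkposreal 1 Rlt_0_1); tauto. }
    destruct Hc as [c Hc].
    destruct (Husc u v (S - c) Hu Hv Hc) as [d Hd].
    destruct (posreal_min d c) as [m [Hm1 Hm2]].
    exists m; intros x y _ _ H1 H2 Hxy.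
    generalize (Hd x y Hxy ltac:(lra) ltac:(lra)); lra.
  - assert (S <= S - d); [|generalize (cond_pos d); lra].
    apply HS2; intros z (x & y & Hxy & ->); destruct (HD x y Hxy); auto.
Qed.

(** At an interior maximum, a positive value of (w F')' would make w F', hence F',
    positive just to the right of the point. *)
Lemma weighted_second_derivative_at_max (F F' w : R -> R) (x0 l : R) (r : posreal) :
  (forall x, Rabs (x - x0) < r -> is_derive F x (F' x) /\ 0 < w x /\ F x <= F x0) ->
  is_derive (fun x => w x * F' x) x0 l -> l <= 0.
Proof.
  intros Hloc Hl; apply Rnot_lt_le; intros Hpos.
  assert (H0 : F' x0 = 0).
  { destruct (Hloc x0) as [Hd _]; [rewrite Rminus_diag, Rabs_R0; apply cond_pos|].
    apply is_derive_Reals in Hd.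
    rewrite <- (derive_pt_eq_0 F x0 _ (exist _ _ Hd) Hd).
    apply (deriv_maximum F (x0 - r) (x0 + r)); try (generalize (cond_pos r); lra).
    intros x H1 H2; apply Hloc, Rabs_def1; lra. }
  apply is_derive_Reals in Hl.
  destruct (Hl (l / 2)) as [d Hd]; [lra|].
  destruct (posreal_min d r) as [m [Hm1 Hm2]].
  assert (Hm := cond_pos m).
  assert (Hincr : forall h, 0 < h < m -> 0 < F' (x0 + h)).
  { intros h Hh.
    assert (H1 : Rabs ((w (x0 + h) * F' (x0 + h) - w x0 * F' x0) / h - l) < l / 2).
    { apply Hd; [lra | apply Rabs_def1; lra]. }
    rewrite H0, Rmult_0_r, Rminus_0_r in H1; apply Rabs_def2 in H1.
    destruct (Hloc (x0 + h)) as (_ & Hw & _); [apply Rabs_def1; lra|].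
    set (q := w (x0 + h) * F' (x0 + h) / h) in H1.
    assert (Hq : w (x0 + h) * F' (x0 + h) = q * h) by (unfold q; field; lra).
    nra. }
  destruct (MVT_cor2 F F' x0 (x0 + m / 2)) as [c [Hc1 Hc2]]; [lra| |].
  - intros x Hx; apply is_derive_Reals, Hloc, Rabs_def1; lra.
  - destruct (Hloc (x0 + m / 2)) as (_ & _ & Hmax); [apply Rabs_def1; lra|].
    specialize (Hincr (c - x0) ltac:(lra)); replace (x0 + (c - x0)) with c in Hincr by ring.
    nra.
Qed.

Lemma off_cut_azimuth (theta phi : R) : PI / 2 < phi < 2 * PI -> ~ on_cut theta phi.
Proof.
  intros Hphi [_ [k Hk]].
  assert (Hpi := PI_RGT_0).
  destruct (Z_le_gt_dec k 0) as [H|H].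
  - apply IZR_le in H; nra.
  - assert (H' : (1 <= k)%Z) by lia; apply IZR_le in H'; nra.
Qed.

Lemma eigen_continuity_eps (l : R) (u : R -> R -> R) (theta phi : R) (eps : posreal) :
  dirichlet_eigenfunction l u -> 0 <= theta <= PI ->
  exists d : posreal, forall t p, 0 <= t <= PI ->
    Rabs (t - theta) < d -> Rabs (p - phi) < d -> Rabs (u t p - u theta phi) < eps.
Proof.
  intros Hu Ht.
  destruct (proj1 (filterlim_locally _ _) (eigen_continuous _ _ Hu theta phi Ht) eps)
    as [d Hd].
  exists d; intros t p Ht' H1 H2.
  exact (Hd (t, p) (conj H1 H2) Ht').
Qed.

(** The barrier is h = ln (sin theta): it tends to -oo at the poles, so that
    u + delta h has a maximum away from them, and its Laplacian is -1.  At that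
    maximum the Laplacian of u is at most delta, while it equals -l u there. *)
Lemma eigenvalue_nonneg (l : R) (u : R -> R -> R) :
  dirichlet_eigenfunction l u ->
  (exists phi, PI / 2 < phi < 2 * PI /\ 0 < u (PI / 2) phi) -> 0 <= l.
Proof.
  intros Hu (p0 & Hp0 & Hup0); apply Rnot_lt_le; intros Hl.
  assert (Hpi := PI_RGT_0).
  set (delta := - l * u (PI / 2) p0 / 2).
  assert (Hdelta : 0 < delta) by (unfold delta; nra).
  set (F := fun t p => u t p + delta * ln (sin t)).
  destruct (rectangle_max 0 PI 0 (2 * PI) (fun t p => 0 < t < PI /\ 0 <= p <= 2 * PI) F
              (PI / 2) p0) as (t1 & p1 & [Ht1 Hp1] & Hmax).
  - intros; lra.
  - lra.
  - intros t p c Ht Hp Hc.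
    destruct (classic (0 < t < PI)) as [Ht'|Ht'].
    + specialize (Hc (conj Ht' Hp)).
      assert (He : 0 < (c - F t p) / 2) by lra.
      destruct (eigen_continuity_eps l u t p (mkposreal _ He) Hu Ht) as [d Hd]; simpl in Hd.
      assert (Hc2 : continuous (fun s => delta * ln (sin s)) t).
      { apply @ex_derive_continuous; auto_derive; apply sin_gt_0; lra. }
      destruct (proj1 (filterlim_locally _ _) Hc2 (mkposreal _ He)) as [d' Hd'].
      destruct (posreal_min d d') as [m [Hm1 Hm2]].
      exists m; intros x y [Hx Hy] H1 H2.
      assert (H3 := Hd x y ltac:(lra) ltac:(lra) ltac:(lra)).
      assert (H4 : Rabs (delta * ln (sin x) - delta * ln (sin t)) < (c - F t p) / 2).
      { apply (Hd' x). apply Rlt_le_trans with (1 := H1); exact Hm2. }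
      apply Rabs_def2 in H3; apply Rabs_def2 in H4.
      unfold F in *; lra.
    + (* at a pole, the barrier wins over the bounded function u *)
      assert (Hs : sin t = 0).
      { destruct (Req_dec t 0) as [->|]; [apply sin_0|].
        replace t with PI by lra; apply sin_PI. }
      destruct (eigen_continuity_eps l u t p (mkposreal 1 Rlt_0_1) Hu Ht) as [d Hd];
        simpl in Hd.
      assert (Hc2 : continuous sin t) by (apply continuous_sin).
      destruct (proj1 (filterlim_locally _ _) Hc2
                  (mkposreal _ (exp_pos ((c - u t p - 1) / delta)))) as [d' Hd'].
      destruct (posreal_min d d') as [m [Hm1 Hm2]].
      exists m; intros x y [Hx Hy] H1 H2.
      assert (H3 := Hd x y ltac:(lra) ltac:(lra) ltac:(lra)).
      assert (H4 : Rabs (sin x - sin t) < exp ((c - u t p - 1) / delta)).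
      { apply (Hd' x). apply Rlt_le_trans with (1 := H1); exact Hm2. }
      rewrite Hs, Rminus_0_r in H4.
      apply Rabs_def2 in H3; apply Rabs_def2 in H4.
      assert (H5 : ln (sin x) < (c - u t p - 1) / delta).
      { rewrite <- (ln_exp ((c - u t p - 1) / delta)).
        apply ln_increasing; [apply sin_gt_0; lra | lra]. }
      assert (H6 : delta * ln (sin x) < c - u t p - 1).
      { replace (c - u t p - 1) with (delta * ((c - u t p - 1) / delta)) by (field; lra).
        apply Rmult_lt_compat_l; lra. }
      unfold F; lra.
  - assert (Hs1 : 0 < sin t1) by (apply sin_gt_0; lra).
    assert (Hln1 : ln (sin t1) <= 0).
    { rewrite <- ln_1; apply ln_le; [exact Hs1 | apply SIN_bound]. }
    assert (Hge : u (PI / 2) p0 <= F t1 p1).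
    { replace (u (PI / 2) p0) with (F (PI / 2) p0); [apply Hmax; lra|].
      unfold F; rewrite sin_PI2, ln_1; ring. }
    assert (Hu1 : u (PI / 2) p0 <= u t1 p1) by (unfold F in Hge; nra).
    assert (Hoff : ~ on_cut t1 p1).
    { intros Hcut; rewrite (eigen_dirichlet _ _ Hu _ _ Hcut) in Hu1; lra. }
    assert (Heq : t1 = PI / 2 -> PI / 2 < p1 < 2 * PI).
    { intros Ht; split; apply Rnot_le_lt; intros Hle; apply Hoff; split; try exact Ht.
      - exists 0%Z; lra.
      - exists 1%Z; lra. }
    (* a neighbourhood of (t1, p1), along both coordinate lines, avoids the cut *)
    assert (Hr : exists r : posreal,
      (forall t, Rabs (t - t1) < r -> 0 < t < PI /\ ~ on_cut t p1) /\
      (forall p, Rabs (p - p1) < r -> ~ on_cut t1 p /\ F t1 p <= F t1 p1)).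
    { assert (Hper : forall p, - (2 * PI) < p < 4 * PI -> F t1 p <= F t1 p1).
      { intros p Hp.
        assert (Hin : forall q, 0 <= q <= 2 * PI -> F t1 q <= F t1 p1)
          by (intros; apply Hmax; auto).
        destruct (Rlt_dec p 0) as [H|H].
        - unfold F in *; rewrite <- (eigen_periodic _ _ Hu t1 p); apply Hin; lra.
        - destruct (Rlt_dec (2 * PI) p) as [H'|H'].
          + unfold F in *; replace p with (p - 2 * PI + 2 * PI) by ring.
            rewrite (eigen_periodic _ _ Hu t1 (p - 2 * PI)); apply Hin; lra.
          + apply Hin; lra. }
      destruct (Req_dec t1 (PI / 2)) as [Ht|Ht].
      - specialize (Heq Ht).
        assert (Hr : 0 < Rmin (Rmin t1 (PI - t1)) (Rmin (p1 - PI / 2) (2 * PI - p1))).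
        { repeat apply Rmin_glb_lt; lra. }
        exists (mkposreal _ Hr); simpl.
        assert (H1 := Rmin_l (Rmin t1 (PI - t1)) (Rmin (p1 - PI / 2) (2 * PI - p1))).
        assert (H2 := Rmin_r (Rmin t1 (PI - t1)) (Rmin (p1 - PI / 2) (2 * PI - p1))).
        assert (H3 := Rmin_l t1 (PI - t1)); assert (H4 := Rmin_r t1 (PI - t1)).
        assert (H5 := Rmin_l (p1 - PI / 2) (2 * PI - p1)).
        assert (H6 := Rmin_r (p1 - PI / 2) (2 * PI - p1)).
        split; intros x Hx; apply Rabs_def2 in Hx; split; try lra.
        + apply off_cut_azimuth; lra.
        + apply off_cut_azimuth; lra.
        + apply Hper; lra.
      - assert (Hr : 0 < Rmin (Rmin t1 (PI - t1)) (Rabs (t1 - PI / 2))).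
        { repeat apply Rmin_glb_lt; try lra; apply Rabs_pos_lt; lra. }
        exists (mkposreal _ Hr); simpl.
        assert (H1 := Rmin_l (Rmin t1 (PI - t1)) (Rabs (t1 - PI / 2))).
        assert (H2 := Rmin_r (Rmin t1 (PI - t1)) (Rabs (t1 - PI / 2))).
        assert (H3 := Rmin_l t1 (PI - t1)); assert (H4 := Rmin_r t1 (PI - t1)).
        split; intros x Hx.
        + assert (Hx' := Hx); apply Rabs_def2 in Hx'; split; [lra|].
          intros [-> _]; rewrite Rabs_minus_sym in Hx; lra.
        + apply Rabs_def2 in Hx; split; [intros [H _]; contradiction | apply Hper; lra]. }
    destruct Hr as (r & Hrt & Hrp).
    destruct (eigen_C2 _ _ Hu t1 p1 Ht1 Hoff) as (_ & _ & _ & Hdt & Hdp).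
    destruct Hdt as (_ & Hdt & _); destruct Hdp as (_ & _ & Hdp & _).
    assert (HA : Derive (fun t => sin t * Derive (fun s => u s p1) t) t1
                 - delta * sin t1 <= 0).
    { apply (weighted_second_derivative_at_max (fun t => F t p1)
        (fun t => Derive (fun s => u s p1) t + delta * (cos t / sin t)) sin t1 _ r).
      - intros t Ht; destruct (Hrt t Ht) as [Ht' Hcut].
        assert (Hst : 0 < sin t) by (apply sin_gt_0; lra).
        split; [|split; [exact Hst | apply Hmax; auto]].
        unfold F; apply @is_derive_plus.
        + apply Derive_correct; destruct (eigen_C2 _ _ Hu t p1 Ht' Hcut) as (_ & H & _).
          exact H.
        + auto_derive; [exact Hst | field; lra].
      - apply is_derive_ext_loc with
          (fun t => sin t * Derive (fun s => u s p1) t + delta * cos t).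
        + exists r; intros t Ht; destruct (Hrt t Ht) as [Ht' _].
          assert (Hst : 0 < sin t) by (apply sin_gt_0; lra); simpl; field; lra.
        + unfold Rminus; apply @is_derive_plus.
          * apply Derive_correct, (ex_derive_mult sin); [auto_derive; exact I | exact Hdt].
          * auto_derive; [exact I | ring]. }
    assert (HB : Derive_n (fun p => u t1 p) 2 p1 <= 0).
    { simpl; apply (weighted_second_derivative_at_max (fun p => F t1 p)
        (fun p => Derive (fun s => u t1 s) p) (fun _ => 1) p1 _ r).
      - intros p Hp; destruct (Hrp p Hp) as [Hcut Hle].
        split; [|split; [lra | exact Hle]].
        unfold F.
        replace (Derive (fun s => u t1 s) p) with (Derive (fun s => u t1 s) p + 0) by ring.
        apply @is_derive_plus; [|apply @is_derive_const].
        apply Derive_correct.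
        destruct (eigen_C2 _ _ Hu t1 p Ht1 Hcut) as (_ & _ & H & _); exact H.
      - apply is_derive_ext with (fun p => Derive (fun s => u t1 s) p);
          [intros; apply eq_sym, Rmult_1_l|]; apply Derive_correct; exact Hdp. }
    assert (HE := eigen_equation _ _ Hu t1 p1 Ht1 Hoff).
    unfold laplace_beltrami in HE.
    set (A := Derive (fun t => sin t * Derive (fun s => u s p1) t) t1) in *.
    set (B := Derive_n (fun p => u t1 p) 2 p1) in *.
    assert (HA' : / sin t1 * A <= delta).
    { apply Rmult_le_reg_l with (1 := Hs1).
      rewrite <- Rmult_assoc, Rinv_r, Rmult_1_l by lra; lra. }
    assert (HB' : / sin t1 ^ 2 * B <= 0).
    { assert (0 < / sin t1 ^ 2) by (apply Rinv_0_lt_compat, pow_lt; lra); nra. }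
    unfold delta in HA'; nra.
Qed.

(** * Euler's Gamma function and the Beta integral *)

Lemma exp_le_1 (t : R) : t <= 0 -> exp t <= 1.
Proof.
  intros [H| ->]; [|rewrite exp_0; apply Rle_refl].
  rewrite <- exp_0; left; apply exp_increasing, H.
Qed.

Definition gamma_density (x t : R) : R := Rpower t (x - 1) * exp (- t).

Lemma is_derive_Rpower (p t : R) :
  0 < t -> is_derive (fun t => Rpower t p) t (p * Rpower t (p - 1)).
Proof. intros Ht; apply is_derive_Reals, derivable_pt_lim_power, Ht. Qed.

Lemma gamma_density_pos (x t : R) : 0 < gamma_density x t.
Proof. apply Rmult_lt_0_compat; apply exp_pos. Qed.

Lemma gamma_density_continuous (x t : R) : 0 < t -> continuous (gamma_density x) t.
Proof.
  intros Ht; unfold gamma_density.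
  apply (continuous_mult (fun t => Rpower t (x - 1)) (fun t => exp (- t))).
  - apply @ex_derive_continuous; eexists; apply is_derive_Rpower, Ht.
  - apply @ex_derive_continuous; auto_derive; exact I.
Qed.

Lemma Gamma_from_primitive (x : R) (F : R -> R) (l0 l1 : R) :
  (forall t, 0 < t -> is_derive F t (gamma_density x t)) ->
  filterlim F (at_right 0) (locally l0) ->
  is_lim F p_infty l1 ->
  Gamma x = l1 - l0.
Proof.
  intros HF H0 H1; unfold Gamma.
  assert (Hgen : is_RInt_gen (V := R_NormedModule) (gamma_density x)
            (at_right 0) (Rbar_locally p_infty) (l1 - l0));
    [|exact (is_RInt_gen_unique (V := R_CompleteNormedModule) _ _ Hgen)].
  assert (Hpos : filter_prod (at_right 0) (Rbar_locally p_infty)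
            (fun ab => forall t, Rmin (fst ab) (snd ab) <= t -> 0 < t)).
  { apply Filter_prod with (fun a => 0 < a) (fun b => 0 < b).
    - exists (mkposreal 1 Rlt_0_1); auto.
    - exists 0; auto.
    - intros a b Ha Hb t; simpl; generalize (Rmin_glb_lt a b 0 Ha Hb); lra. }
  apply is_RInt_gen_ext with (Derive F).
  { eapply filter_imp; [|exact Hpos]; intros ab Hab t Ht.
    apply is_derive_unique, HF, Hab; lra. }
  apply is_RInt_gen_Derive.
  - eapply filter_imp; [|exact Hpos]; intros ab Hab t Ht.
    eexists; apply HF, Hab; lra.
  - eapply filter_imp; [|exact Hpos]; intros ab Hab t Ht.
    assert (Ht0 : 0 < t) by (apply Hab; lra).
    apply continuous_ext_loc with (gamma_density x); [|apply gamma_density_continuous, Ht0].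
    exists (mkposreal _ Ht0); intros z Hz.
    apply eq_sym, is_derive_unique, HF.
    change (Rabs (z - t) < t) in Hz; apply Rabs_def2 in Hz; lra.
  - exact H0.
  - exact H1.
Qed.

Lemma monotone_bounded_limit (h : R -> R) (K : R) :
  (forall x y, 0 < x -> x <= y -> h x <= h y) -> (forall x, 0 < x -> h x <= K) ->
  exists l : R, is_lim h p_infty l /\ forall x, 0 < x -> h x <= l.
Proof.
  intros Hmon Hbd.
  destruct (completeness (fun z => exists x, 0 < x /\ z = h x)) as [l [Hl1 Hl2]].
  { exists K; intros z (x & Hx & ->); auto. }
  { exists (h 1), 1; split; [lra | reflexivity]. }
  assert (Hle : forall x, 0 < x -> h x <= l).
  { intros x Hx; apply Hl1; exists x; auto. }
  exists l; split; [|exact Hle].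
  apply is_lim_spec; intros eps; simpl.
  assert (He := cond_pos eps).
  assert (Hex : exists x, 0 < x /\ l - eps < h x).
  { apply NNPP; intros Hno; assert (l <= l - eps); [|lra].
    apply Hl2; intros z (x & Hx & ->); apply Rnot_lt_le; intros H; apply Hno.
    exists x; auto. }
  destruct Hex as (x & Hx & Hxl); exists x; intros y Hy.
  assert (h x <= h y) by (apply Hmon; lra).
  assert (h y <= l) by (apply Hle; lra).
  apply Rabs_def1; lra.
Qed.

Lemma increment_le (F G F' G' : R -> R) (a b : R) :
  a <= b ->
  (forall x, a <= x <= b -> is_derive F x (F' x)) ->
  (forall x, a <= x <= b -> is_derive G x (G' x)) ->
  (forall x, a <= x <= b -> F' x <= G' x) ->
  F b - F a <= G b - G a.
Proof.
  intros Hab HF HG Hle.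
  destruct (Req_dec a b) as [->|Hne]; [lra|].
  destruct (MVT_cor2 (fun x => G x - F x) (fun x => G' x - F' x) a b) as [c [Hc1 Hc2]].
  - lra.
  - intros x Hx; apply derivable_pt_lim_minus; apply is_derive_Reals; auto.
  - assert (F' c <= G' c) by (apply Hle; lra).
    assert (0 <= (G' c - F' c) * (b - a)) by (apply Rmult_le_pos; lra); lra.
Qed.

(** G is the lower incomplete Gamma function.  It is given as the primitive with limit 0
    at 0 because its density is unbounded there when x < 1. *)
Record incomplete_gamma (x : R) (G : R -> R) : Prop := {
  incgamma_derive : forall y, 0 < y -> is_derive G y (gamma_density x y);
  incgamma_at_0 : filterlim G (at_right 0) (locally 0);
  incgamma_lim : is_lim G p_infty (Gamma x);
  incgamma_nonneg : forall y, 0 < y -> 0 <= G y;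
  incgamma_le : forall y, 0 < y -> G y <= Gamma x
}.

(** The power t^(x - 1) is absorbed by exp (t / 2). *)
Lemma gamma_density_tail (x : R) :
  exists K, forall t, 1 <= t -> gamma_density x t <= exp K * exp (- (t / 2)).
Proof.
  (* ln (t / c) <= t / c - 1, with c large enough for |x - 1| / c <= 1/2 *)
  set (c := 2 * (Rabs (x - 1) + 1)).
  assert (Ha := Rabs_pos (x - 1)).
  assert (Hc : 0 < c) by (unfold c; lra).
  exists (Rabs (x - 1) * ln c); intros t Ht.
  unfold gamma_density, Rpower; rewrite <- 2!exp_plus.
  assert (Hln0 : 0 <= ln t) by (rewrite <- ln_1; apply ln_le; lra).
  assert (Hln : ln t <= t / c + ln c).
  { assert (Htc : 0 < t / c) by (apply Rdiv_lt_0_compat; lra).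
    replace t with (t / c * c) at 1 by (field; lra).
    rewrite ln_mult by lra.
    generalize (exp_ineq1_le (ln (t / c))); rewrite exp_ln by exact Htc; lra. }
  assert (H1 : (x - 1) * ln t <= Rabs (x - 1) * ln t).
  { apply Rmult_le_compat_r; [exact Hln0 | apply Rle_abs]. }
  assert (H2 : Rabs (x - 1) * ln t <= Rabs (x - 1) * (t / c + ln c)).
  { apply Rmult_le_compat_l; assumption. }
  assert (H3 : Rabs (x - 1) * (t / c) <= t / 2).
  { replace (Rabs (x - 1) * (t / c)) with (t / 2 * (Rabs (x - 1) / (Rabs (x - 1) + 1))).
    - rewrite <- (Rmult_1_r (t / 2)) at 2; apply Rmult_le_compat_l; [lra|].
      apply Rmult_le_reg_r with (Rabs (x - 1) + 1); [lra|].
      unfold Rdiv; rewrite Rmult_assoc, Rinv_l; lra.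
    - unfold c; field; lra. }
  assert (H4 : (x - 1) * ln t + - t <= Rabs (x - 1) * ln c + - (t / 2)) by lra.
  destruct H4 as [H4| ->]; [left; apply exp_increasing, H4 | right; reflexivity].
Qed.

(** The density is dominated by t^(x - 1), of primitive t^x / x, near 0, and by a
    decaying exponential at infinity; its monotone primitive thus has finite limits at
    both ends. *)
Lemma incomplete_gamma_exists (x : R) : 0 < x -> exists G, incomplete_gamma x G.
Proof.
  intros Hx.
  set (E := fun y => RInt (gamma_density x) 1 y).
  assert (HE : forall y, 0 < y -> is_derive E y (gamma_density x y)).
  { intros y Hy; apply (is_derive_RInt (gamma_density x) E 1).
    - exists (mkposreal _ Hy); intros z Hz.
      change (Rabs (z - y) < y) in Hz; apply Rabs_def2 in Hz.
      apply (RInt_correct (gamma_density x) 1 z), (ex_RInt_continuous (gamma_density x)).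
      intros t [Ht _]; apply gamma_density_continuous.
      apply Rlt_le_trans with (2 := Ht), Rmin_glb_lt; lra.
    - apply gamma_density_continuous, Hy. }
  assert (HE1 : E 1 = 0) by apply (RInt_point 1 (gamma_density x)).
  assert (Hmon : forall y z, 0 < y -> y <= z -> E y <= E z).
  { intros y z Hy Hyz.
    generalize (increment_le (fun _ => 0) E (fun _ => 0) (gamma_density x) y z Hyz).
    intros H; cut (0 - 0 <= E z - E y); [lra|]; apply H.
    - intros; apply @is_derive_const.
    - intros t Ht; apply HE; lra.
    - intros t _; apply Rlt_le, gamma_density_pos. }
  destruct (gamma_density_tail x) as [K HK].
  destruct (monotone_bounded_limit E (2 * exp K) Hmon) as (l1 & Hl1 & Hle1).
  { intros y Hy; assert (HeK := exp_pos K).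
    destruct (Rle_dec y 1) as [H|H].
    - generalize (Hmon y 1 Hy H); lra.
    - assert (Hc := increment_le E (fun t => - 2 * exp K * exp (- (t / 2))) (gamma_density x)
        (fun t => exp K * exp (- (t / 2))) 1 y ltac:(lra)).
      assert (H1 := exp_pos (- (y / 2))).
      assert (H2 : exp (- (1 / 2)) <= 1).
      { apply exp_le_1; lra. }
      assert (H3 : E y - E 1 <= - 2 * exp K * exp (- (y / 2)) - - 2 * exp K * exp (- (1 / 2))).
      { apply Hc.
        - intros t Ht; apply HE; lra.
        - intros t Ht; auto_derive; [exact I | unfold Rdiv; field].
        - intros t Ht; apply HK; lra. }
      nra. }
  destruct (monotone_bounded_limit (fun z => - E (/ z)) (/ x)) as (l0 & Hl0 & Hle0).
  { intros y z Hy Hyz; apply Ropp_le_contravar, Hmon.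
    - apply Rinv_0_lt_compat; lra.
    - apply Rinv_le_contravar; lra. }
  { intros z Hz; assert (Hz' : 0 < / z) by (apply Rinv_0_lt_compat, Hz).
    destruct (Rle_dec (/ z) 1) as [H|H].
    - assert (H3 : E 1 - E (/ z) <= / x * Rpower 1 x - / x * Rpower (/ z) x).
      { apply (increment_le E (fun t => / x * Rpower t x) (gamma_density x)
          (fun t => Rpower t (x - 1)) (/ z) 1 H).
        - intros t Ht; apply HE; lra.
        - intros t Ht.
          replace (Rpower t (x - 1)) with (/ x * (x * Rpower t (x - 1))) by (field; lra).
          apply (is_derive_scal (fun t => Rpower t x)), is_derive_Rpower; lra.
        - intros t Ht; unfold gamma_density; rewrite <- (Rmult_1_r (Rpower t (x - 1))) at 2.
          apply Rmult_le_compat_l; [left; apply exp_pos|].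
          apply exp_le_1; lra. }
      replace (Rpower 1 x) with 1 in H3 by (unfold Rpower; rewrite ln_1, Rmult_0_r, exp_0; auto).
      assert (H4 : 0 < Rpower (/ z) x) by apply exp_pos.
      assert (H5 : 0 < / x) by (apply Rinv_0_lt_compat, Hx); nra.
    - generalize (Hmon 1 (/ z) Rlt_0_1 ltac:(lra)).
      assert (H5 : 0 < / x) by (apply Rinv_0_lt_compat, Hx); lra. }
  assert (HE0 : filterlim E (at_right 0) (locally (- l0))).
  { apply filterlim_ext_loc with (fun y => - - E (/ / y)).
    - exists (mkposreal 1 Rlt_0_1); intros y _ Hy; rewrite Rinv_inv; ring.
    - apply (filterlim_comp _ _ _ (fun y => - E (/ / y)) Ropp _ (locally l0)).
      + apply (filterlim_comp _ _ _ Rinv (fun z => - E (/ z)) _ _ _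
          filterlim_Rinv_0_right Hl0).
      + apply (filterlim_opp (V := R_NormedModule)). }
  assert (HGam : Gamma x = l1 - - l0) by (apply Gamma_from_primitive with E; auto).
  exists (fun y => E y + l0); split.
  - intros y Hy; replace (gamma_density x y) with (gamma_density x y + 0) by ring.
    apply @is_derive_plus; [apply HE, Hy | apply @is_derive_const].
  - replace 0 with (- l0 + l0) at 2 by ring.
    apply (filterlim_comp_2 (H := locally l0) E (fun _ => l0) Rplus HE0).
    + apply filterlim_const.
    + apply (filterlim_plus (V := R_NormedModule)).
  - rewrite HGam; replace (l1 - - l0) with (l1 + l0) by ring.
    apply (is_lim_plus' E (fun _ => l0)); [exact Hl1 | apply is_lim_const].
  - intros y Hy; generalize (Hle0 (/ y) (Rinv_0_lt_compat _ Hy)); rewrite Rinv_inv; lra.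
  - intros y Hy; generalize (Hle1 y Hy); lra.
Qed.

Lemma incomplete_gamma_monotone (x : R) (G : R -> R) (y z : R) :
  incomplete_gamma x G -> 0 < y <= z -> G y <= G z.
Proof.
  intros HG Hyz.
  cut (0 - 0 <= G z - G y); [lra|].
  apply (increment_le (fun _ => 0) G (fun _ => 0) (gamma_density x)); try lra.
  - intros; apply @is_derive_const.
  - intros t Ht; apply (incgamma_derive _ _ HG); lra.
  - intros t _; apply Rlt_le, gamma_density_pos.
Qed.

Lemma incomplete_gamma_continuous (x : R) (G : R -> R) (y : R) :
  incomplete_gamma x G -> 0 < y -> continuous G y.
Proof.
  intros HG Hy; apply @ex_derive_continuous; eexists; apply (incgamma_derive _ _ HG), Hy.
Qed.

Lemma Gamma_pos (x : R) : 0 < x -> 0 < Gamma x.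
Proof.
  intros Hx; destruct (incomplete_gamma_exists x Hx) as [G HG].
  destruct (MVT_cor2 G (gamma_density x) 1 2) as [c [Hc1 Hc2]]; [lra| |].
  - intros t Ht; apply is_derive_Reals, (incgamma_derive _ _ HG); lra.
  - assert (H1 := gamma_density_pos x c).
    assert (H2 := incgamma_nonneg _ _ HG 1 Rlt_0_1).
    assert (H3 := incgamma_le _ _ HG 2 ltac:(lra)); lra.
Qed.

Lemma eq_from_derivative_and_limit_at_0 (F G d : R -> R) (y : R) :
  (forall t, 0 < t -> is_derive F t (d t)) ->
  (forall t, 0 < t -> is_derive G t (d t)) ->
  filterlim F (at_right 0) (locally 0) ->
  filterlim G (at_right 0) (locally 0) ->
  0 < y -> F y = G y.
Proof.
  intros HF HG HF0 HG0 Hy.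
  assert (Hlim : filterlim (fun t => F t - G t) (at_right 0) (locally (F y - G y))).
  { apply filterlim_ext_loc with (fun _ => F y - G y); [|apply filterlim_const].
    exists (mkposreal _ Hy); intros t Ht Ht0.
    change (Rabs (t - 0) < y) in Ht; apply Rabs_def2 in Ht.
    assert (F y - F t <= G y - G t)
      by (apply (increment_le F G d d); intros; try apply HF; try apply HG; lra).
    assert (G y - G t <= F y - F t)
      by (apply (increment_le G F d d); intros; try apply HF; try apply HG; lra).
    lra. }
  assert (Hlim0 : filterlim (fun t => F t - G t) (at_right 0) (locally (0 + - 0))).
  { apply (filterlim_comp_2 (H := locally (- 0)) F (fun t => - G t) Rplus HF0).
    - apply (filterlim_comp _ _ _ G Ropp _ _ _ HG0), (filterlim_opp (V := R_NormedModule)).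
    - apply (filterlim_plus (V := R_NormedModule)). }
  assert (H := filterlim_locally_unique _ _ _ Hlim Hlim0); lra.
Qed.

Ltac continuity_2d :=
  repeat first
    [ assumption | apply continuity_2d_pt_const | apply continuity_2d_pt_id1 | apply continuity_2d_pt_id2
    | apply continuity_2d_pt_plus | apply continuity_2d_pt_minus
    | apply continuity_2d_pt_mult | apply continuity_2d_pt_opp ].

Lemma continuous_2d_comp (f : R -> R) (g : R -> R -> R) (x y : R) :
  continuous f (g x y) -> continuity_2d_pt g x y ->
  continuity_2d_pt (fun u v => f (g u v)) x y.
Proof.
  intros Hf; apply (continuity_1d_2d_pt_comp f g).
  apply continuity_pt_filterlim, Hf.
Qed.

(** The substitution t = u^2 has removed the square root from the integrand
    t^(1/2) (1 + t)^(-s) of the Beta function B(3/2, s - 3/2). *)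
Definition beta_integral (s U : R) : R :=
  RInt (fun u => 2 * u ^ 2 * Rpower (1 + u ^ 2) (- s)) 0 U.

Lemma continuous_Rpower (p t : R) : 0 < t -> continuous (fun t => Rpower t p) t.
Proof.
  intros Ht; apply @ex_derive_continuous; eexists; apply is_derive_Rpower, Ht.
Qed.

Lemma beta_integrand_continuous (s u : R) :
  continuous (fun u => 2 * u ^ 2 * Rpower (1 + u ^ 2) (- s)) u.
Proof.
  apply (continuous_mult (fun u => 2 * u ^ 2) (fun u => Rpower (1 + u ^ 2) (- s))).
  - apply @ex_derive_continuous; auto_derive; exact I.
  - apply (continuous_comp (fun u => 1 + u ^ 2) (fun t => Rpower t (- s))).
    + apply @ex_derive_continuous; auto_derive; exact I.
    + apply continuous_Rpower; generalize (pow2_ge_0 u); lra.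
Qed.

Lemma Rpower_neg_le_1 (s u : R) : 0 <= s -> 0 < Rpower (1 + u ^ 2) (- s) <= 1.
Proof.
  intros Hs; split; [apply exp_pos|]; apply exp_le_1.
  assert (0 <= ln (1 + u ^ 2)); [|nra].
  rewrite <- ln_1; apply ln_le; generalize (pow2_ge_0 u); lra.
Qed.

(** Substitution t = y u^2 in the incomplete Gamma function of order 3/2. *)
Lemma incomplete_gamma_3_2 (G : R -> R) (U y : R) :
  incomplete_gamma (3 / 2) G -> 0 < y -> 0 < U ->
  RInt (fun u => 2 * u ^ 2 * exp (- (y * u ^ 2))) 0 U = Rpower y (- (3 / 2)) * G (y * U ^ 2).
Proof.
  intros HG Hy HU.
  set (f := fun v => 2 * v ^ 2 * exp (- v ^ 2)).
  assert (Hfc : forall v, continuous f v).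
  { intros v; apply @ex_derive_continuous; unfold f; auto_derive; exact I. }
  assert (Hex : forall a b, ex_RInt f a b).
  { intros a b; apply (ex_RInt_continuous f); auto. }
  assert (Hd : forall V, is_derive (fun V => RInt f 0 V) V (f V)).
  { intros V; apply (is_derive_RInt f _ 0); [|apply Hfc].
    apply filter_forall; intros; apply (RInt_correct f), Hex. }
  assert (Hs : 0 < sqrt y) by (apply sqrt_lt_R0, Hy).
  assert (Hss : sqrt y * sqrt y = y) by (apply sqrt_sqrt; lra).
  assert (HsR : Rpower y (3 / 2) = y * sqrt y).
  { replace (3 / 2) with (1 + / 2) by field.
    rewrite Rpower_plus, Rpower_1, Rpower_sqrt; auto. }
  assert (Hlink : RInt f 0 (sqrt y * U) = G (y * U ^ 2)).
  { replace (sqrt y * U) with (sqrt (y * U ^ 2)).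
    2:{ rewrite sqrt_mult_alt by lra; rewrite sqrt_pow2; lra. }
    apply (eq_from_derivative_and_limit_at_0 (fun z => RInt f 0 (sqrt z)) G
             (gamma_density (3 / 2))).
    - intros t Ht.
      assert (Hst : 0 < sqrt t) by (apply sqrt_lt_R0, Ht).
      assert (Htt : sqrt t ^ 2 = t) by (apply pow2_sqrt; lra).
      replace (gamma_density (3 / 2) t) with (/ (2 * sqrt t) * f (sqrt t)).
      + apply (is_derive_comp (fun V => RInt f 0 V) sqrt); [apply Hd|].
        auto_derive; [exact Ht | field; lra].
      + unfold f, gamma_density.
        replace (3 / 2 - 1) with (/ 2) by field.
        rewrite Rpower_sqrt, Htt by exact Ht.
        replace (2 * t) with (2 * (sqrt t * sqrt t)) by (rewrite sqrt_sqrt; lra).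
        field; lra.
    - apply (incgamma_derive _ _ HG).
    - replace 0 with (RInt f 0 (sqrt 0)) at 2
        by (rewrite sqrt_0; apply (RInt_point 0 f)).
      eapply filterlim_filter_le_1; [apply filter_le_within|].
      apply (continuous_comp sqrt (fun V => RInt f 0 V)).
      + apply continuous_sqrt.
      + apply @ex_derive_continuous; eexists; apply Hd.
    - apply (incgamma_at_0 _ _ HG).
    - apply Rmult_lt_0_compat; [exact Hy | apply pow_lt, HU]. }
  rewrite Rpower_Ropp, HsR, <- Hlink.
  assert (Hlin := RInt_comp_lin f (sqrt y) 0 0 U (Hex _ _)).
  rewrite Rmult_0_r, !Rplus_0_r in Hlin; rewrite <- Hlin.
  apply Rmult_eq_reg_l with (y * sqrt y); [|nra].
  rewrite <- Rmult_assoc, Rinv_r, Rmult_1_l by nra.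
  rewrite <- (RInt_scal (V := R_CompleteNormedModule) _ 0 U (y * sqrt y)).
  - apply RInt_ext; intros u _; unfold f, scal; simpl; unfold mult; simpl.
    replace ((sqrt y * u + 0) * ((sqrt y * u + 0) * 1)) with (y * (u * (u * 1)))
      by (rewrite <- Hss at 1; ring).
    ring.
  - apply (ex_RInt_continuous (V := R_CompleteNormedModule)); intros v _.
    apply @ex_derive_continuous; auto_derive; exact I.
Qed.

(** A truncation in y and u of the double integral of
      2 u^2 y^(nu + 1/2) exp (- y (1 + u^2)),
    in which the integration in y has been carried out (G is an incomplete Gamma
    function).  At y = +oo it is Gamma (nu + 3/2) times the Beta integral, while its
    y-derivative is the inner integral in u, an incomplete Gamma function of order 3/2
    times the Gamma density of order nu. *)
Definition beta_gamma (nu : R) (G : R -> R) (U y : R) : R :=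
  RInt (fun u => 2 * u ^ 2 * Rpower (1 + u ^ 2) (- (nu + 3 / 2)) * G (y * (1 + u ^ 2))) 0 U.

Lemma is_derive_beta_gamma (nu : R) (G G3 : R -> R) (U y : R) :
  incomplete_gamma (nu + 3 / 2) G -> incomplete_gamma (3 / 2) G3 -> 0 < U -> 0 < y ->
  is_derive (beta_gamma nu G U) y (gamma_density nu y * G3 (y * U ^ 2)).
Proof.
  intros HG HG3 HU Hy; set (s := nu + 3 / 2) in *.
  assert (Hu1 : forall u, 1 <= 1 + u ^ 2) by (intros u; generalize (pow2_ge_0 u); lra).
  set (f := fun y u => 2 * u ^ 2 * Rpower (1 + u ^ 2) (- s) * G (y * (1 + u ^ 2))).
  set (df := fun y u => 2 * u ^ 2 * Rpower (1 + u ^ 2) (- s) *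
               ((1 + u ^ 2) * gamma_density s (y * (1 + u ^ 2)))).
  assert (Hdf : forall z u, 0 < z -> is_derive (fun z => f z u) z (df z u)).
  { intros z u Hz; apply is_derive_scal.
    apply (is_derive_comp G (fun z => z * (1 + u ^ 2))).
    - apply (incgamma_derive _ _ HG), Rmult_lt_0_compat; [exact Hz|].
      generalize (Hu1 u); lra.
    - auto_derive; [exact I | ring]. }
  assert (Hloc : locally y (fun z => 0 < z)).
  { apply (open_gt 0 y Hy). }
  replace (gamma_density nu y * G3 (y * U ^ 2)) with (RInt (fun u => Derive (fun z => f z u) y) 0 U).
  - apply (is_derive_RInt_param f 0 U y).
    + eapply filter_imp; [|exact Hloc]; intros z Hz t _; eexists; apply Hdf, Hz.
    + intros t _; apply continuity_2d_pt_ext_loc with df.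
      * destruct Hloc as [d Hd]; exists d; intros z u Hz _.
        apply eq_sym, is_derive_unique, Hdf, Hd, Hz.
      * unfold df, gamma_density.
        assert (Hp : continuity_2d_pt (fun _ u => 1 + u ^ 2) y t).
        { unfold pow; continuity_2d. }
        assert (Hyp : continuity_2d_pt (fun z u => z * (1 + u ^ 2)) y t).
        { apply (continuity_2d_pt_mult (fun z _ => z) (fun _ u => 1 + u ^ 2)); auto.
          continuity_2d. }
        assert (H1 := Hu1 t).
        repeat apply continuity_2d_pt_mult; auto; try solve [unfold pow; continuity_2d].
        -- apply (continuous_2d_comp (fun x => Rpower x (- s)) (fun _ u => 1 + u ^ 2)); auto.
           apply continuous_Rpower; lra.
        -- apply (continuous_2d_comp (fun x => Rpower x (s - 1)) (fun z u => z * (1 + u ^ 2)));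
             auto.
           apply continuous_Rpower; nra.
        -- apply (continuous_2d_comp (fun x => exp (- x)) (fun z u => z * (1 + u ^ 2))); auto.
           apply @ex_derive_continuous; auto_derive; exact I.
    + eapply filter_imp; [|exact Hloc]; intros z Hz.
      apply (ex_RInt_continuous (V := R_CompleteNormedModule)); intros u _.
      apply (continuous_mult (fun u => 2 * u ^ 2 * Rpower (1 + u ^ 2) (- s))
               (fun u => G (z * (1 + u ^ 2)))).
      * apply beta_integrand_continuous.
      * apply (continuous_comp (fun u => z * (1 + u ^ 2)) G).
        -- apply @ex_derive_continuous; auto_derive; exact I.
        -- apply (incomplete_gamma_continuous s G); [exact HG|].
           apply Rmult_lt_0_compat; [exact Hz | generalize (Hu1 u); lra].
  - rewrite (RInt_ext _ (fun u => scal (Rpower y (s - 1) * exp (- y))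
                                    (2 * u ^ 2 * exp (- (y * u ^ 2))))).
    + rewrite (RInt_scal (V := R_CompleteNormedModule)).
      * rewrite (incomplete_gamma_3_2 G3) by auto.
        unfold scal; simpl; unfold mult; simpl; unfold gamma_density.
        replace (nu - 1) with ((s - 1) + - (3 / 2)) by (unfold s; field).
        rewrite Rpower_plus; ring.
      * apply (ex_RInt_continuous (V := R_CompleteNormedModule)); intros v _.
        apply @ex_derive_continuous; auto_derive; exact I.
    + intros u _; transitivity (df y u); [apply is_derive_unique, Hdf, Hy|].
      assert (H1 := Hu1 u).
      unfold df, gamma_density, scal; simpl; unfold mult; simpl.
      rewrite <- Rpower_mult_distr by lra.
      change (u * (u * 1)) with (u ^ 2).
      replace (Rpower (1 + u ^ 2) (s - 1)) with
        (Rpower (1 + u ^ 2) s * / (1 + u ^ 2)).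
      2:{ unfold Rminus; rewrite Rpower_plus, Rpower_Ropp, Rpower_1; auto; lra. }
      rewrite Rpower_Ropp.
      replace (exp (- (y * (1 + u ^ 2)))) with (exp (- y) * exp (- (y * (u ^ 2))))
        by (rewrite <- exp_plus; f_equal; ring).
      field; split; [lra|]; apply Rgt_not_eq, exp_pos.
Qed.

(** G increases from G y towards Gamma (nu + 3/2) on the range of its argument.  The
    second pair of bounds gives the limit 0 as y -> 0. *)
Lemma beta_gamma_bounds (nu : R) (G : R -> R) (U y : R) :
  0 < nu -> incomplete_gamma (nu + 3 / 2) G -> 0 < U -> 0 < y ->
  G y * beta_integral (nu + 3 / 2) U <= beta_gamma nu G U y
    <= Gamma (nu + 3 / 2) * beta_integral (nu + 3 / 2) U /\
  0 <= beta_gamma nu G U y <= U * (2 * U ^ 2 * G (y * (1 + U ^ 2))).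
Proof.
  intros Hnu HG HU Hy; set (s := nu + 3 / 2) in *.
  assert (Hexb : ex_RInt (fun u => 2 * u ^ 2 * Rpower (1 + u ^ 2) (- s)) 0 U).
  { apply (ex_RInt_continuous (V := R_CompleteNormedModule)); intros v _.
    apply beta_integrand_continuous. }
  assert (Hu1 : forall u, 1 <= 1 + u ^ 2) by (intros u; generalize (pow2_ge_0 u); lra).
  assert (Hexg : ex_RInt (fun u => 2 * u ^ 2 * Rpower (1 + u ^ 2) (- s) * G (y * (1 + u ^ 2))) 0 U).
  { apply (ex_RInt_continuous (V := R_CompleteNormedModule)); intros u _.
    apply (continuous_mult (fun u => 2 * u ^ 2 * Rpower (1 + u ^ 2) (- s))
             (fun u => G (y * (1 + u ^ 2)))).
    - apply beta_integrand_continuous.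
    - apply (continuous_comp (fun u => y * (1 + u ^ 2)) G).
      + apply @ex_derive_continuous; auto_derive; exact I.
      + apply (incomplete_gamma_continuous s G); [exact HG|].
        apply Rmult_lt_0_compat; [exact Hy | generalize (Hu1 u); lra]. }
  assert (Hw : forall u, 0 <= 2 * u ^ 2 * Rpower (1 + u ^ 2) (- s) <= 2 * u ^ 2).
  { intros u; assert (H0 := pow2_ge_0 u).
    destruct (Rpower_neg_le_1 s u) as [H1 H2]; [unfold s; lra|]; split.
    - apply Rmult_le_pos; lra.
    - rewrite <- (Rmult_1_r (2 * u ^ 2)) at 2; apply Rmult_le_compat_l; lra. }
  assert (HGu : forall u, 0 < y * (1 + u ^ 2)).
  { intros u; generalize (Hu1 u); nra. }
  assert (HGpos : forall u, 0 <= G (y * (1 + u ^ 2))).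
  { intros u; apply (incgamma_nonneg _ _ HG), HGu. }
  repeat split; unfold beta_gamma, beta_integral; fold s.
  - rewrite <- (RInt_scal (V := R_CompleteNormedModule) _ 0 U (G y)) by exact Hexb.
    apply RInt_le; [lra | apply (ex_RInt_scal (V := R_NormedModule)), Hexb | exact Hexg |].
    intros u _; unfold scal; simpl; unfold mult; simpl; rewrite Rmult_comm.
    apply Rmult_le_compat_l; [apply Hw|].
    apply (incomplete_gamma_monotone s G); [exact HG|]; split; [exact Hy|].
    generalize (Hu1 u); simpl; nra.
  - rewrite <- (RInt_scal (V := R_CompleteNormedModule) _ 0 U (Gamma s)) by exact Hexb.
    apply RInt_le; [lra | exact Hexg | apply (ex_RInt_scal (V := R_NormedModule)), Hexb |].
    intros u _; unfold scal; simpl; unfold mult; simpl; rewrite Rmult_comm.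
    apply Rmult_le_compat_r; [apply Hw|].
    apply (incgamma_le _ _ HG), HGu.
  - apply RInt_ge_0; [lra | exact Hexg |].
    intros u _; apply Rmult_le_pos; [apply Hw | apply HGpos].
  - replace (U * (2 * U ^ 2 * G (y * (1 + U ^ 2)))) with
      (RInt (fun _ => 2 * U ^ 2 * G (y * (1 + U ^ 2))) 0 U).
    2:{ rewrite RInt_const; unfold scal; simpl; unfold mult; simpl; ring. }
    apply RInt_le; [lra | exact Hexg | apply (ex_RInt_const (V := R_NormedModule)) |].
    intros u Hu; apply Rmult_le_compat; [apply Hw | apply HGpos | |].
    + apply Rle_trans with (1 := proj2 (Hw u)); nra.
    + apply (incomplete_gamma_monotone s G); [exact HG|]; split; [apply HGu|].
      apply Rmult_le_compat_l; nra.
Qed.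

(** The weight of the density of order nu in the derivative of beta_gamma is at most
    Gamma (3/2), and at least its value at y = d beyond d.  Integrate over (0, +oo) for
    the upper bound, over (d, +oo) for the lower one. *)
Lemma beta_integral_bounds (nu : R) (G3 Gn : R -> R) (U d : R) :
  0 < nu -> incomplete_gamma (3 / 2) G3 -> incomplete_gamma nu Gn -> 0 < U -> 0 < d ->
  G3 (d * U ^ 2) * (Gamma nu - Gn d) <= Gamma (nu + 3 / 2) * beta_integral (nu + 3 / 2) U
    <= Gamma (3 / 2) * Gamma nu.
Proof.
  intros Hnu HG3 HGn HU Hd.
  assert (HU2 : 0 < U ^ 2) by (apply pow_lt, HU).
  destruct (incomplete_gamma_exists (nu + 3 / 2)) as [G HG]; [lra|].
  set (P := beta_gamma nu G U).
  assert (HdP := fun y Hy => is_derive_beta_gamma nu G G3 U y HG HG3 HU Hy).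
  assert (HB := fun y Hy => beta_gamma_bounds nu G U y Hnu HG HU Hy).
  split.
  - assert (H : forall y, d < y -> G3 (d * U ^ 2) * (Gn y - Gn d) <=
        Gamma (nu + 3 / 2) * beta_integral (nu + 3 / 2) U).
    { intros y Hy; apply Rle_trans with (P y - P d).
      - rewrite Rmult_minus_distr_l.
        apply (increment_le (fun y => G3 (d * U ^ 2) * Gn y) P
          (fun y => G3 (d * U ^ 2) * gamma_density nu y)
          (fun y => gamma_density nu y * G3 (y * U ^ 2))); [lra | | |].
        + intros t Ht; apply is_derive_scal, (incgamma_derive _ _ HGn); lra.
        + intros t Ht; apply HdP; lra.
        + intros t Ht; rewrite Rmult_comm; apply Rmult_le_compat_l.
          * apply Rlt_le, gamma_density_pos.
          * apply (incomplete_gamma_monotone _ _ _ _ HG3); nra.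
      - destruct (HB y ltac:(lra)) as [[_ H1] _]; destruct (HB d Hd) as [_ [H2 _]].
        unfold P; lra. }
    apply (is_lim_le_loc (fun y => G3 (d * U ^ 2) * (Gn y - Gn d))
      (fun _ => Gamma (nu + 3 / 2) * beta_integral (nu + 3 / 2) U) p_infty
      (G3 (d * U ^ 2) * (Gamma nu - Gn d))
      (Gamma (nu + 3 / 2) * beta_integral (nu + 3 / 2) U)).
    + exists d; exact H.
    + apply (is_lim_scal_l (fun y => Gn y - Gn d) (G3 (d * U ^ 2)) p_infty (Gamma nu - Gn d)).
      apply is_lim_minus'; [apply (incgamma_lim _ _ HGn) | apply is_lim_const].
    + apply is_lim_const.
  - assert (H : forall y, 0 < y -> G y * beta_integral (nu + 3 / 2) U <=
                                    Gamma (3 / 2) * Gamma nu).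
    { intros y Hy; apply Rle_trans with (P y); [apply (HB y Hy)|].
      assert (Hz : forall z, 0 < z < y ->
        P y <= Gamma (3 / 2) * Gamma nu + U * (2 * U ^ 2 * G (z * (1 + U ^ 2)))).
      { intros z Hz.
        assert (H1 : P y - P z <= Gamma (3 / 2) * Gn y - Gamma (3 / 2) * Gn z).
        { apply (increment_le P (fun y => Gamma (3 / 2) * Gn y)
            (fun y => gamma_density nu y * G3 (y * U ^ 2))
            (fun y => Gamma (3 / 2) * gamma_density nu y)); [lra | | |].
          - intros t Ht; apply HdP; lra.
          - intros t Ht; apply is_derive_scal, (incgamma_derive _ _ HGn); lra.
          - intros t Ht; rewrite (Rmult_comm (Gamma (3 / 2))); apply Rmult_le_compat_l.
            + apply Rlt_le, gamma_density_pos.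
            + apply (incgamma_le _ _ HG3); nra. }
        assert (H2 := Gamma_pos (3 / 2) ltac:(lra)).
        assert (H3 := incgamma_nonneg _ _ HGn z ltac:(lra)).
        assert (H4 := incgamma_le _ _ HGn y ltac:(lra)).
        destruct (HB z ltac:(lra)) as [_ [_ H5]]; fold P in H5; nra. }
      assert (Hl : filterlim (fun z => Gamma (3 / 2) * Gamma nu
          + U * (2 * U ^ 2 * G (z * (1 + U ^ 2)))) (at_right 0)
          (locally (Gamma (3 / 2) * Gamma nu + U * (2 * U ^ 2 * 0)))).
      { assert (HGz : filterlim (fun z => G (z * (1 + U ^ 2))) (at_right 0) (locally 0)).
        { apply (filterlim_comp _ _ _ (fun z => z * (1 + U ^ 2)) G _ (at_right 0)).
          - intros Q [e He]; assert (He' : 0 < e / (1 + U ^ 2)).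
            { apply Rdiv_lt_0_compat; [apply cond_pos | lra]. }
            exists (mkposreal _ He'); intros z Hzb Hz0.
            change (Rabs (z - 0) < e / (1 + U ^ 2)) in Hzb; apply Rabs_def2 in Hzb.
            assert (Hz1 : 0 < z * (1 + U ^ 2)) by (apply Rmult_lt_0_compat; lra).
            apply He; [|exact Hz1].
            change (Rabs (z * (1 + U ^ 2) - 0) < e); rewrite Rminus_0_r, Rabs_pos_eq by lra.
            replace (pos e) with (e / (1 + U ^ 2) * (1 + U ^ 2)) by (field; lra).
            apply Rmult_lt_compat_r; lra.
          - apply (incgamma_at_0 _ _ HG). }
        apply (filterlim_comp _ _ _ (fun z => G (z * (1 + U ^ 2)))
          (fun w => Gamma (3 / 2) * Gamma nu + U * (2 * U ^ 2 * w)) _ _ _ HGz).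
        apply (@ex_derive_continuous R_AbsRing R_NormedModule
          (fun w => Gamma (3 / 2) * Gamma nu + U * (2 * U ^ 2 * w)) 0).
        auto_derive; exact I. }
      rewrite 2!Rmult_0_r, Rplus_0_r in Hl.
      apply (filterlim_le (F := at_right 0) (fun _ => P y) _ (P y) (Gamma (3 / 2) * Gamma nu))
        with (3 := Hl); [|apply filterlim_const].
      exists (mkposreal _ Hy); intros z Hzb Hz0; apply Hz.
      change (Rabs (z - 0) < y) in Hzb; apply Rabs_def2 in Hzb; lra. }
    apply (is_lim_le_loc (fun y => G y * beta_integral (nu + 3 / 2) U)
      (fun _ => Gamma (3 / 2) * Gamma nu) p_infty
      (Gamma (nu + 3 / 2) * beta_integral (nu + 3 / 2) U) (Gamma (3 / 2) * Gamma nu)).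
    + exists 0; exact H.
    + apply (is_lim_scal_r G (beta_integral (nu + 3 / 2) U) p_infty (Gamma (nu + 3 / 2))).
      apply (incgamma_lim _ _ HG).
    + apply is_lim_const.
Qed.

Lemma is_lim_Rinv_at_right_0 (F : R -> R) (l : R) :
  filterlim F (at_right 0) (locally l) -> is_lim (fun x => F (/ x)) p_infty l.
Proof.
  intros HF; apply (filterlim_comp _ _ _ Rinv F _ (at_right 0)); [|exact HF].
  intros Q [e He]; exists (/ e); intros x Hx.
  assert (He0 := cond_pos e).
  assert (Hie : 0 < / e) by (apply Rinv_0_lt_compat, He0).
  assert (Hix : 0 < / x) by (apply Rinv_0_lt_compat; lra).
  apply He; [|exact Hix].
  change (Rabs (/ x - 0) < e); rewrite Rminus_0_r, Rabs_pos_eq by lra.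
  rewrite <- (Rinv_inv e); apply Rinv_lt_contravar; [apply Rmult_lt_0_compat; lra | exact Hx].
Qed.

(** Take d = 1 / U in the bounds. *)
Lemma beta_integral_lim (nu : R) :
  0 < nu ->
  is_lim (beta_integral (nu + 3 / 2)) p_infty
    (Gamma (3 / 2) * Gamma nu / Gamma (nu + 3 / 2)).
Proof.
  intros Hnu.
  destruct (incomplete_gamma_exists (3 / 2)) as [G3 HG3]; [lra|].
  destruct (incomplete_gamma_exists nu Hnu) as [Gn HGn].
  assert (HG := Gamma_pos (nu + 3 / 2) ltac:(lra)).
  apply is_lim_le_le_loc with
    (f := fun U => G3 U * (Gamma nu - Gn (/ U)) / Gamma (nu + 3 / 2))
    (g := fun _ => Gamma (3 / 2) * Gamma nu / Gamma (nu + 3 / 2)).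
  - exists 0; intros U HU.
    destruct (beta_integral_bounds nu G3 Gn U (/ U) Hnu HG3 HGn HU) as [H1 H2].
    { apply Rinv_0_lt_compat, HU. }
    replace (/ U * U ^ 2) with U in H1 by (field; lra).
    split; (apply Rmult_le_reg_l with (1 := HG); unfold Rdiv;
      rewrite (Rmult_comm _ (/ Gamma (nu + 3 / 2))), <- Rmult_assoc, Rinv_r, Rmult_1_l by lra;
      assumption).
  - apply (is_lim_scal_r (fun U => G3 U * (Gamma nu - Gn (/ U))) (/ Gamma (nu + 3 / 2))
      p_infty (Gamma (3 / 2) * Gamma nu)).
    apply (is_lim_mult G3 (fun U => Gamma nu - Gn (/ U)) p_infty (Gamma (3 / 2)) (Gamma nu)).
    + apply (incgamma_lim _ _ HG3).
    + replace (Finite (Gamma nu)) with (Finite (Gamma nu - 0)) by (f_equal; ring).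
      apply is_lim_minus'; [apply is_lim_const|].
      apply is_lim_Rinv_at_right_0, (incgamma_at_0 _ _ HGn).
    + exact I.
  - apply is_lim_const.
Qed.

Lemma is_lim_inv_pow (n : nat) : (0 < n)%nat -> is_lim (fun x => / x ^ n) p_infty 0.
Proof.
  intros Hn.
  apply (is_lim_ext (fun x => (/ x) ^ n)); [intros; apply pow_inv|].
  apply (is_lim_Rinv_at_right_0 (fun y => y ^ n)).
  eapply filterlim_filter_le_1; [apply filter_le_within|].
  replace 0 with (0 ^ n) at 2 by (apply pow_i, Hn).
  apply (@ex_derive_continuous R_AbsRing R_NormedModule (fun y => y ^ n)); auto_derive; exact I.
Qed.

Lemma Gamma_3 : Gamma 3 = 2.
Proof.
  replace 2 with (0 - - 2) by ring.
  apply Gamma_from_primitive with (fun t => - (t ^ 2 + 2 * t + 2) * exp (- t)).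
  - intros t Ht; unfold gamma_density.
    replace (3 - 1) with (INR 2) by (simpl; ring).
    rewrite Rpower_pow by exact Ht.
    auto_derive; [exact I | ring].
  - eapply filterlim_filter_le_1; [apply filter_le_within|].
    replace (- 2) with (- (0 ^ 2 + 2 * 0 + 2) * exp (- 0)) by (rewrite Ropp_0, exp_0; ring).
    apply (@ex_derive_continuous R_AbsRing R_NormedModule
      (fun t => - (t ^ 2 + 2 * t + 2) * exp (- t))); auto_derive; exact I.
  - (* exp t >= (1 + t / 3)^3 >= t^3 / 27, and t^2 + 2 t + 2 <= 5 t^2 for t >= 1 *)
    apply is_lim_le_le_loc with (f := fun t => - (150 * / t ^ 1)) (g := fun _ => 0).
    + exists 1; intros t Ht.
      assert (H1 : (1 + t / 3) ^ 3 <= exp t).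
      { replace (exp t) with (exp (t / 3) ^ 3).
        - apply pow_incr; split; [lra | apply exp_ineq1_le].
        - simpl; rewrite Rmult_1_r, <- !exp_plus; f_equal; field. }
      assert (H2 : t ^ 3 / 27 <= exp t).
      { apply Rle_trans with (2 := H1); simpl; nra. }
      assert (H0 := exp_pos t).
      assert (H3 : (t ^ 2 + 2 * t + 2) * t <= 150 * exp t).
      { apply Rle_trans with (150 * (t ^ 3 / 27)); [simpl; nra | lra]. }
      rewrite exp_Ropp, pow_1.
      split.
      * rewrite Ropp_mult_distr_l_reverse; apply Ropp_le_contravar.
        apply Rmult_le_reg_r with (exp t * t); [apply Rmult_lt_0_compat; lra|].
        field_simplify; lra.
      * assert (0 < / exp t) by (apply Rinv_0_lt_compat, H0); simpl; nra.
    + apply (is_lim_ext (fun t => - 150 * / t ^ 1)); [intros; ring|].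
      replace (Finite 0) with (Rbar_mult (- 150) 0) by (simpl; f_equal; ring).
      apply is_lim_scal_l, is_lim_inv_pow; lia.
    + apply is_lim_const.
Qed.

Lemma is_lim_atan_p_infty : is_lim atan p_infty (PI / 2).
Proof.
  apply (is_lim_ext_loc (fun x => PI / 2 - atan (/ x))).
  - exists 0; intros x Hx; rewrite atan_inv by exact Hx; ring.
  - rewrite <- (Rminus_0_r (PI / 2)) at 1; rewrite <- atan_0 at 1.
    apply (is_lim_Rinv_at_right_0 (fun y => PI / 2 - atan y)).
    eapply filterlim_filter_le_1; [apply filter_le_within|].
    apply (@ex_derive_continuous R_AbsRing R_NormedModule (fun y => PI / 2 - atan y)).
    auto_derive; exact I.
Qed.

Lemma beta_integral_3 : is_lim (beta_integral 3) p_infty (PI / 8).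
Proof.
  apply (is_lim_ext_loc (fun U => / 4 * (atan U + U / (1 + U ^ 2) - 2 * U / (1 + U ^ 2) ^ 2))).
  - exists 0; intros U HU; apply eq_sym, is_RInt_unique.
    set (F := fun U => / 4 * (atan U + U / (1 + U ^ 2) - 2 * U / (1 + U ^ 2) ^ 2)).
    change (is_RInt (fun u => 2 * u ^ 2 * Rpower (1 + u ^ 2) (- (3))) 0 U (F U)).
    assert (HF0 : F 0 = 0) by (unfold F, Rdiv; rewrite atan_0, Rmult_0_r, !Rmult_0_l; ring).
    replace (F U) with (F U - F 0) by (rewrite HF0; ring).
    apply (is_RInt_derive F).
    + intros u _; assert (Hu := pow2_ge_0 u).
      replace (- (3)) with (- INR 3) by (simpl; ring).
      rewrite Rpower_Ropp, Rpower_pow by lra.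
      unfold F; auto_derive.
      * repeat split; simpl in Hu; nra.
      * unfold Rsqr; field; nra.
    + intros u _; apply beta_integrand_continuous.
  - replace (Finite (PI / 8)) with (Rbar_mult (/ 4) (PI / 2)) by (simpl; f_equal; field).
    apply is_lim_scal_l.
    replace (PI / 2) with (PI / 2 + 0 - 0) by ring.
    apply is_lim_minus'; [apply is_lim_plus'|].
    + apply is_lim_atan_p_infty.
    + apply is_lim_le_le_loc with (f := fun _ => 0) (g := fun U => / U ^ 1).
      * exists 0; intros U HU; assert (HU2 := pow_lt U 2 HU); split.
        -- apply Rlt_le, Rdiv_lt_0_compat; lra.
        -- apply Rmult_le_reg_r with (U * (1 + U ^ 2)); [apply Rmult_lt_0_compat; lra|].
           field_simplify; lra.
      * apply is_lim_const.
      * apply is_lim_inv_pow; lia.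
    + apply is_lim_le_le_loc with (f := fun _ => 0) (g := fun U => / U ^ 1).
      * exists 0; intros U HU; assert (HU2 := pow_lt U 2 HU); split.
        -- apply Rlt_le, Rdiv_lt_0_compat; [lra | apply pow_lt; lra].
        -- apply Rmult_le_reg_r with (U * (1 + U ^ 2) ^ 2);
             [apply Rmult_lt_0_compat; [lra | apply pow_lt; lra]|].
           field_simplify; [|lra|lra]. assert (0 < U ^ 4) by (apply pow_lt, HU); lra.
      * apply is_lim_const.
      * apply is_lim_inv_pow; lia.
Qed.

(** The Beta integral at nu = 3/2 is elementary, and there the identity reads
    Gamma (3/2)^2 = Gamma 3 * (PI / 8). *)
Lemma Gamma_3_2 : Gamma (3 / 2) = sqrt PI / 2.
Proof.
  assert (HG := Gamma_pos (3 / 2) ltac:(lra)).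
  assert (H := beta_integral_lim (3 / 2) ltac:(lra)).
  replace (3 / 2 + 3 / 2) with 3 in H by field.
  apply is_lim_unique in H; rewrite (is_lim_unique _ _ _ beta_integral_3) in H.
  injection H; clear H; rewrite Gamma_3; intros H.
  replace (Gamma (3 / 2)) with (sqrt (Gamma (3 / 2) * Gamma (3 / 2)))
    by (apply sqrt_square; lra).
  replace (Gamma (3 / 2) * Gamma (3 / 2)) with (PI / (2 * 2)) by lra.
  rewrite sqrt_div_alt, sqrt_square; lra.
Qed.

Lemma continuity_2d_section (f : R -> R -> R) (x y : R) :
  continuity_2d_pt f x y -> continuous (f x) y.
Proof.
  intros Hf; apply filterlim_locally; intros eps; destruct (Hf eps) as [d Hd].
  exists d; intros v Hv; apply (Hd x v); [|exact Hv].
  rewrite Rminus_diag, Rabs_R0; apply cond_pos.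
Qed.

Lemma is_lim_Rpower_neg (p : R) : p < 0 -> is_lim (fun x => Rpower x p) p_infty 0.
Proof.
  intros Hp; apply (is_lim_comp exp (fun x => p * ln x) p_infty 0 m_infty).
  - apply is_lim_exp_m.
  - apply is_lim_spec; intros M; exists (exp (M / p)); intros x Hx.
    assert (H : M / p < ln x).
    { rewrite <- (ln_exp (M / p)); apply ln_increasing; [apply exp_pos | exact Hx]. }
    replace M with (p * (M / p)) by (field; lra); nra.
  - exists 0; intros; discriminate.
Qed.

(** * Rotation of the ray of integration *)

(** Re (e^(i kappa) z^(-s)) for z = x + i y with x > 0.  Its values at
    kappa = 0 and kappa = -PI/2 are the real and imaginary parts of z^(-s). *)
Definition kernel (s kappa x y : R) : R :=
  exp (- (s / 2) * ln (x ^ 2 + y ^ 2)) * cos (kappa - s * atan (y / x)).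

Lemma kernel_derive (s : R) (k x y : R -> R) (t dk dx dy : R) :
  0 < x t ->
  is_derive k t dk -> is_derive x t dx -> is_derive y t dy ->
  is_derive (fun t => kernel s (k t) (x t) (y t)) t
    (- (s * (x t * dx + y t * dy) / (x t ^ 2 + y t ^ 2)) * kernel s (k t) (x t) (y t)
     + (dk - s * (x t * dy - y t * dx) / (x t ^ 2 + y t ^ 2))
       * kernel s (k t + PI / 2) (x t) (y t)).
Proof.
  intros Hx Hk Hdx Hdy.
  assert (HN : 0 < x t ^ 2 + y t ^ 2).
  { generalize (pow2_ge_0 (y t)) (pow_lt (x t) 2 Hx); lra. }
  unfold kernel.
  replace (cos (k t + PI / 2 - s * atan (y t / x t)))
    with (- sin (k t - s * atan (y t / x t))).
  2:{ replace (k t + PI / 2 - s * atan (y t / x t))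
        with (k t - s * atan (y t / x t) + PI / 2) by ring.
      rewrite cos_plus, cos_PI2, sin_PI2; ring. }
  auto_derive.
  - repeat split; try (eexists; eassumption); try lra; simpl in HN; lra.
  - replace (Derive (fun t => k t) t) with dk by (symmetry; apply is_derive_unique, Hk).
    replace (Derive (fun t => x t) t) with dx by (symmetry; apply is_derive_unique, Hdx).
    replace (Derive (fun t => y t) t) with dy by (symmetry; apply is_derive_unique, Hdy).
    unfold Rsqr.
    set (e := exp _). set (c := cos _). set (si := sin _).
    field; simpl in HN; repeat split; nra.
Qed.

Lemma kernel_half_turn (s kappa x y : R) :
  kernel s (kappa + PI / 2 + PI / 2) x y = - kernel s kappa x y.
Proof.
  unfold kernel.
  replace (kappa + PI / 2 + PI / 2 - s * atan (y / x)) with (kappa - s * atan (y / x) + PI)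
    by field.
  rewrite neg_cos; ring.
Qed.

Lemma kernel_continuity_2d (s : R) (k x y : R -> R -> R) (u v : R) :
  0 < x u v ->
  continuity_2d_pt k u v -> continuity_2d_pt x u v -> continuity_2d_pt y u v ->
  continuity_2d_pt (fun u v => kernel s (k u v) (x u v) (y u v)) u v.
Proof.
  intros Hx Hk Hcx Hcy; unfold kernel.
  assert (HN : 0 < x u v ^ 2 + y u v ^ 2).
  { generalize (pow2_ge_0 (y u v)) (pow_lt (x u v) 2 Hx); lra. }
  apply continuity_2d_pt_mult.
  - apply (continuous_2d_comp (fun N => exp (- (s / 2) * ln N))
      (fun u v => x u v ^ 2 + y u v ^ 2)).
    + apply @ex_derive_continuous; auto_derive; exact HN.
    + unfold pow; continuity_2d.
  - apply (continuous_2d_comp cos (fun u v => k u v - s * atan (y u v / x u v))).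
    + apply continuous_cos.
    + continuity_2d; try assumption.
      apply (continuous_2d_comp atan (fun u v => y u v / x u v)).
      * apply @ex_derive_continuous; auto_derive; exact I.
      * unfold Rdiv; continuity_2d; try assumption.
        apply continuity_2d_pt_inv; [assumption | lra].
Qed.

Lemma kernel_bound (s kappa x y : R) :
  0 <= s -> 0 < x -> Rabs (kernel s kappa x y) <= Rpower x (- s).
Proof.
  intros Hs Hx; unfold kernel; rewrite Rabs_mult.
  rewrite <- (Rmult_1_r (Rpower x (- s))).
  apply Rmult_le_compat; try apply Rabs_pos.
  - rewrite Rabs_pos_eq by apply Rlt_le, exp_pos; unfold Rpower.
    assert (H : 2 * ln x <= ln (x ^ 2 + y ^ 2)).
    { replace (2 * ln x) with (ln (x ^ 2)) by (rewrite ln_pow; [simpl; ring | exact Hx]).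
      apply ln_le; [apply pow_lt, Hx | generalize (pow2_ge_0 y); lra]. }
    assert (H' : - (s / 2) * ln (x ^ 2 + y ^ 2) <= - s * ln x) by nra.
    destruct H' as [H'|H']; [left; apply exp_increasing, H' | right; f_equal; exact H'].
  - apply Rabs_le, COS_bound.
Qed.

Lemma kernel_polar (s kappa m a : R) :
  0 < m -> - (PI / 2) < a < PI / 2 ->
  kernel s kappa (m * cos a) (m * sin a) = Rpower m (- s) * cos (kappa - s * a).
Proof.
  intros Hm Ha; assert (Hc : 0 < cos a) by (apply cos_gt_0; lra).
  unfold kernel, Rpower; f_equal.
  - replace ((m * cos a) ^ 2 + (m * sin a) ^ 2) with (m ^ 2).
    + rewrite ln_pow by exact Hm; f_equal; simpl; field.
    + replace ((m * cos a) ^ 2 + (m * sin a) ^ 2) with (m ^ 2 * (Rsqr (sin a) + Rsqr (cos a)))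
        by (unfold Rsqr; ring).
      rewrite sin2_cos2; ring.
  - replace (m * sin a / (m * cos a)) with (tan a) by (unfold tan; field; lra).
    rewrite atan_tan; [reflexivity | lra].
Qed.

(** Re (e^(i kappa) F), where F = w^(3/2) 2 u^2 (a + w u^2)^(-s), w = e^(i tau) and
    a = A + i B. *)
Definition ray_integrand (s A B kappa tau u : R) : R :=
  2 * u ^ 2 * kernel s (kappa + 3 * tau / 2) (A + u ^ 2 * cos tau) (B + u ^ 2 * sin tau).

(** By homogeneity in w u^2, the tau-derivative of F is the u-derivative
    of (i u / 2) F; this is the real part of (i u / 2) F, up to e^(i kappa). *)
Definition ray_conjugate (s A B kappa tau u : R) : R :=
  u ^ 3 * kernel s (kappa + 3 * tau / 2 + PI / 2)
            (A + u ^ 2 * cos tau) (B + u ^ 2 * sin tau).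

Definition ray_derivative (s A B kappa tau u : R) : R :=
  let x := A + u ^ 2 * cos tau in
  let y := B + u ^ 2 * sin tau in
  2 * u ^ 2 *
    (- (s * (x * - (u ^ 2 * sin tau) + y * (u ^ 2 * cos tau)) / (x ^ 2 + y ^ 2))
       * kernel s (kappa + 3 * tau / 2) x y
     + (3 / 2 - s * (x * (u ^ 2 * cos tau) - y * - (u ^ 2 * sin tau)) / (x ^ 2 + y ^ 2))
       * kernel s (kappa + 3 * tau / 2 + PI / 2) x y).

Lemma ray_abscissa_pos (A tau u : R) :
  0 < A -> - (PI / 2) < tau < PI / 2 -> 0 < A + u ^ 2 * cos tau.
Proof.
  intros HA Ht; assert (Hc : 0 < cos tau) by (apply cos_gt_0; lra).
  generalize (pow2_ge_0 u); nra.
Qed.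

Lemma is_derive_ray_integrand (s A B kappa tau u : R) :
  0 < A -> - (PI / 2) < tau < PI / 2 ->
  is_derive (fun tau => ray_integrand s A B kappa tau u) tau
    (ray_derivative s A B kappa tau u).
Proof.
  intros HA Ht; unfold ray_integrand, ray_derivative.
  apply is_derive_scal.
  apply (kernel_derive s (fun t => kappa + 3 * t / 2) (fun t => A + u ^ 2 * cos t)
    (fun t => B + u ^ 2 * sin t) tau).
  - apply ray_abscissa_pos; assumption.
  - auto_derive; [exact I | field].
  - auto_derive; [exact I | ring].
  - auto_derive; [exact I | ring].
Qed.

Lemma is_derive_ray_conjugate (s A B kappa tau u : R) :
  0 < A -> - (PI / 2) < tau < PI / 2 ->
  is_derive (ray_conjugate s A B kappa tau) u (ray_derivative s A B kappa tau u).
Proof.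
  intros HA Ht; unfold ray_conjugate.
  assert (Hx := ray_abscissa_pos A tau u HA Ht).
  assert (Hk := kernel_derive s (fun _ => kappa + 3 * tau / 2 + PI / 2)
    (fun u => A + u ^ 2 * cos tau) (fun u => B + u ^ 2 * sin tau) u 0
    (2 * u * cos tau) (2 * u * sin tau) Hx).
  assert (Hu : is_derive (fun u => u ^ 3) u (3 * u ^ 2)) by (auto_derive; [exact I | ring]).
  specialize (Hk ltac:(apply @is_derive_const) ltac:(auto_derive; [exact I | ring])
    ltac:(auto_derive; [exact I | ring])).
  evar_last; [apply (is_derive_mult _ _ u _ _ Hu Hk); intros; apply Rmult_comm|].
  cbv beta; rewrite kernel_half_turn.
  unfold ray_derivative, plus, mult; simpl.
  field.
  assert (H0 := pow2_ge_0 (B + u ^ 2 * sin tau)).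
  assert (H1 := pow_lt _ 2 Hx); simpl in *; lra.
Qed.

Lemma ray_integrand_continuous (s A B kappa t u : R) :
  0 < A -> - (PI / 2) < t < PI / 2 -> continuous (ray_integrand s A B kappa t) u.
Proof.
  intros HA Ht; unfold ray_integrand.
  apply (continuous_mult (fun u => 2 * u ^ 2)
    (fun u => kernel s (kappa + 3 * t / 2) (A + u ^ 2 * cos t) (B + u ^ 2 * sin t))).
  - apply @ex_derive_continuous; auto_derive; exact I.
  - apply @ex_derive_continuous; eexists.
    apply (kernel_derive s (fun _ => kappa + 3 * t / 2)
      (fun u => A + u ^ 2 * cos t) (fun u => B + u ^ 2 * sin t) u 0
      (2 * u * cos t) (2 * u * sin t)).
    + apply ray_abscissa_pos; assumption.
    + apply @is_derive_const.
    + auto_derive; [exact I | ring].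
    + auto_derive; [exact I | ring].
Qed.

(** The derivative of the integral with respect to the angle is the boundary term of
    the conjugate at u = U (it vanishes at u = 0), which decays like U^(3 - 2 s). *)
Lemma ray_integral_rotation (s A B kappa t0 t1 th : R) :
  3 / 2 < s -> 0 < A -> th < PI / 2 -> - th <= t0 <= th -> - th <= t1 <= th ->
  is_lim (fun U => RInt (ray_integrand s A B kappa t1) 0 U -
                   RInt (ray_integrand s A B kappa t0) 0 U) p_infty 0.
Proof.
  intros Hs HA Hth Ht0 Ht1.
  assert (Hc : 0 < cos th) by (apply cos_gt_0; lra).
  set (C := Rpower (cos th) (- s) * Rabs (t1 - t0)).
  assert (Hrange : forall t, Rmin t0 t1 <= t <= Rmax t0 t1 -> - th <= t <= th).
  { intros t Ht; split.
    - apply Rle_trans with (2 := proj1 Ht), Rmin_glb; lra.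
    - apply Rle_trans with (1 := proj2 Ht), Rmax_lub; lra. }
  assert (Hcont : forall t u, - (PI / 2) < t < PI / 2 ->
            continuous (ray_integrand s A B kappa t) u).
  { intros t u Ht; apply ray_integrand_continuous; assumption. }
  assert (Hderiv : forall U t, - th <= t <= th ->
    is_derive (fun t => RInt (ray_integrand s A B kappa t) 0 U) t
      (ray_conjugate s A B kappa t U)).
  { intros U t Ht.
    assert (Hloc : locally t (fun z => - (PI / 2) < z < PI / 2)).
    { apply (open_and _ _ (open_gt (- (PI / 2))) (open_lt (PI / 2)) t); split; lra. }
    assert (Hcd : forall z u, - (PI / 2) < z < PI / 2 ->
              continuity_2d_pt (ray_derivative s A B kappa) z u).
    { intros z u Hz; unfold ray_derivative.
      assert (Hx := ray_abscissa_pos A z u HA Hz).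
      assert (Hcx : continuity_2d_pt (fun z u => A + u ^ 2 * cos z) z u).
      { unfold pow; continuity_2d.
        apply (continuous_2d_comp cos (fun z _ => z)); [apply continuous_cos | continuity_2d]. }
      assert (Hcy : continuity_2d_pt (fun z u => B + u ^ 2 * sin z) z u).
      { unfold pow; continuity_2d.
        apply (continuous_2d_comp sin (fun z _ => z)); [apply continuous_sin | continuity_2d]. }
      assert (Hcs : continuity_2d_pt (fun z u => u ^ 2 * sin z) z u).
      { unfold pow; continuity_2d.
        apply (continuous_2d_comp sin (fun z _ => z)); [apply continuous_sin | continuity_2d]. }
      assert (Hcc : continuity_2d_pt (fun z u => u ^ 2 * cos z) z u).
      { unfold pow; continuity_2d.
        apply (continuous_2d_comp cos (fun z _ => z)); [apply continuous_cos | continuity_2d]. }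
      assert (Hcn : continuity_2d_pt (fun z u =>
                / ((A + u ^ 2 * cos z) ^ 2 + (B + u ^ 2 * sin z) ^ 2)) z u).
      { refine (continuity_2d_pt_inv
          (fun z u => (A + u ^ 2 * cos z) ^ 2 + (B + u ^ 2 * sin z) ^ 2) z u _ _).
        - unfold pow at 1 3; continuity_2d.
        - apply Rgt_not_eq; cbv beta; generalize (pow_lt _ 2 Hx) (pow2_ge_0 (B + u ^ 2 * sin z)); lra. }
      assert (Hk : continuity_2d_pt (fun z u => kernel s (kappa + 3 * z / 2)
                (A + u ^ 2 * cos z) (B + u ^ 2 * sin z)) z u).
      { apply (kernel_continuity_2d s (fun z _ => kappa + 3 * z / 2)
          (fun z u => A + u ^ 2 * cos z) (fun z u => B + u ^ 2 * sin z)); auto.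
        unfold Rdiv; continuity_2d. }
      assert (Hk2 : continuity_2d_pt (fun z u => kernel s (kappa + 3 * z / 2 + PI / 2)
                (A + u ^ 2 * cos z) (B + u ^ 2 * sin z)) z u).
      { apply (kernel_continuity_2d s (fun z _ => kappa + 3 * z / 2 + PI / 2)
          (fun z u => A + u ^ 2 * cos z) (fun z u => B + u ^ 2 * sin z)); auto.
        unfold Rdiv; continuity_2d. }
      assert (Hu2 : continuity_2d_pt (fun _ u => u ^ 2) z u) by (unfold pow; continuity_2d).
      unfold Rdiv; continuity_2d. }
    replace (ray_conjugate s A B kappa t U)
      with (RInt (fun u => Derive (fun z => ray_integrand s A B kappa z u) t) 0 U).
    - apply (is_derive_RInt_param (ray_integrand s A B kappa) 0 U t).
      + eapply filter_imp; [|exact Hloc]; intros z Hz u _; eexists.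
        apply is_derive_ray_integrand; assumption.
      + intros u _; apply continuity_2d_pt_ext_loc with (ray_derivative s A B kappa).
        * destruct Hloc as [d Hd]; exists d; intros z v Hz _.
          apply eq_sym, is_derive_unique, is_derive_ray_integrand; [exact HA | apply Hd, Hz].
        * apply Hcd; lra.
      + eapply filter_imp; [|exact Hloc]; intros z Hz.
        apply (ex_RInt_continuous (V := R_CompleteNormedModule)); intros u _; auto.
    - apply is_RInt_unique.
      replace (ray_conjugate s A B kappa t U) with
        (ray_conjugate s A B kappa t U - ray_conjugate s A B kappa t 0)
        by (unfold ray_conjugate; ring).
      apply is_RInt_ext with (ray_derivative s A B kappa t).
      { intros u _; apply eq_sym, is_derive_unique, is_derive_ray_integrand; lra. }
      apply (is_RInt_derive (ray_conjugate s A B kappa t)).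
      + intros u _; apply is_derive_ray_conjugate; lra.
      + intros u _; apply (continuity_2d_section (ray_derivative s A B kappa)), Hcd; lra. }
  assert (Hbound : forall U, 0 < U ->
    Rabs (RInt (ray_integrand s A B kappa t1) 0 U - RInt (ray_integrand s A B kappa t0) 0 U)
      <= C * Rpower U (3 - 2 * s)).
  { intros U HU.
    destruct (MVT_gen (fun t => RInt (ray_integrand s A B kappa t) 0 U) t0 t1
      (fun t => ray_conjugate s A B kappa t U)) as (t & Ht & ->).
    - intros t Ht; apply Hderiv, Hrange; lra.
    - intros t Ht; apply derivable_continuous_pt.
      exists (ray_conjugate s A B kappa t U); apply is_derive_Reals, Hderiv, Hrange, Ht.
    - rewrite Rabs_mult; unfold C.
      replace (Rpower (cos th) (- s) * Rabs (t1 - t0) * Rpower U (3 - 2 * s))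
        with (Rpower (cos th) (- s) * Rpower U (3 - 2 * s) * Rabs (t1 - t0)) by ring.
      apply Rmult_le_compat_r; [apply Rabs_pos|].
      specialize (Hrange t Ht).
      assert (Hct : cos th <= cos t).
      { destruct (Rle_dec 0 t) as [H|H].
        - apply cos_decr_1; lra.
        - rewrite <- (cos_neg t); apply cos_decr_1; lra. }
      assert (HU2 : 0 < U ^ 2) by (apply pow_lt, HU).
      assert (HU3 : 0 < U ^ 3) by (apply pow_lt, HU).
      unfold ray_conjugate; rewrite Rabs_mult, (Rabs_pos_eq (U ^ 3)) by lra.
      apply Rle_trans with (U ^ 3 * Rpower (A + U ^ 2 * cos t) (- s)).
      { apply Rmult_le_compat_l; [lra|]; apply kernel_bound; [lra|].
        apply ray_abscissa_pos; lra. }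
      apply Rle_trans with (U ^ 3 * Rpower (U ^ 2 * cos th) (- s)).
      { apply Rmult_le_compat_l; [lra|]; rewrite 2!Rpower_Ropp.
        apply Rinv_le_contravar; [apply exp_pos|].
        apply Rle_Rpower_l; [lra|]; nra. }
      rewrite <- Rpower_mult_distr by lra.
      right; replace (3 - 2 * s) with (INR 3 + (INR 2 * - s)) by (simpl; ring).
      rewrite Rpower_plus, <- Rpower_mult, !Rpower_pow by exact HU; ring. }
  assert (Hlim : is_lim (fun U => C * Rpower U (3 - 2 * s)) p_infty 0).
  { replace (Finite 0) with (Rbar_mult C 0) by (simpl; f_equal; ring).
    apply is_lim_scal_l, is_lim_Rpower_neg; lra. }
  apply is_lim_le_le_loc with (f := fun U => - (C * Rpower U (3 - 2 * s)))
    (g := fun U => C * Rpower U (3 - 2 * s)).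
  - exists 0; intros U HU; specialize (Hbound U HU); apply Rabs_le_between in Hbound; lra.
  - replace (Finite 0) with (Rbar_opp 0) by (simpl; f_equal; ring); apply is_lim_opp, Hlim.
  - exact Hlim.
Qed.

(** Along the direction of rho e^(i a) both the argument and the modulus of
    rho e^(i a) factor out. *)
Lemma ray_integral_aligned (nu rho a kappa U : R) :
  0 < rho -> - (PI / 2) < a < PI / 2 -> 0 < U ->
  RInt (ray_integrand (nu + 3 / 2) (rho * cos a) (rho * sin a) kappa a) 0 U =
  cos (kappa - nu * a) * Rpower rho (- nu) * beta_integral (nu + 3 / 2) (/ sqrt rho * U).
Proof.
  intros Hrho Ha HU; set (s := nu + 3 / 2).
  set (q := / sqrt rho).
  assert (Hsq : 0 < sqrt rho) by (apply sqrt_lt_R0, Hrho).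
  assert (Hq : 0 < q) by (apply Rinv_0_lt_compat, Hsq).
  assert (Hqq : rho * q ^ 2 = 1).
  { unfold q; rewrite <- (sqrt_sqrt rho) at 1 by lra; field; lra. }
  set (g := fun u => 2 * u ^ 2 * Rpower (1 + u ^ 2) (- s)).
  assert (Hex : ex_RInt g (q * 0 + 0) (q * U + 0)).
  { apply (ex_RInt_continuous (V := R_CompleteNormedModule)); intros u _.
    apply beta_integrand_continuous. }
  assert (Hlin := RInt_comp_lin g q 0 0 U Hex).
  rewrite Rmult_0_r, !Rplus_0_r in Hlin.
  unfold beta_integral; fold g; rewrite <- Hlin.
  rewrite <- (RInt_scal (V := R_CompleteNormedModule) _ 0 U
    (cos (kappa - nu * a) * Rpower rho (- nu))).
  2:{ apply (ex_RInt_comp_lin g q 0 0 U Hex). }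
  apply RInt_ext; intros u _.
  unfold ray_integrand, g, scal; simpl; unfold mult; simpl.
  change (u * (u * 1)) with (u ^ 2).
  replace ((q * u + 0) * ((q * u + 0) * 1)) with (q ^ 2 * u ^ 2) by ring.
  replace (rho * cos a + u ^ 2 * cos a) with ((rho + u ^ 2) * cos a) by ring.
  replace (rho * sin a + u ^ 2 * sin a) with ((rho + u ^ 2) * sin a) by ring.
  assert (Hu := pow2_ge_0 u).
  rewrite kernel_polar by lra.
  replace (kappa + 3 * a / 2 - s * a) with (kappa - nu * a) by (unfold s; field).
  replace (Rpower (rho + u ^ 2) (- s))
    with (Rpower rho (- nu) * q ^ 3 * Rpower (1 + q ^ 2 * u ^ 2) (- s)); [ring|].
  replace (q ^ 3) with (Rpower rho (- (3 / 2))).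
  2:{ replace (- (3 / 2)) with (- / 2 * INR 3) by (simpl; field).
      rewrite <- Rpower_mult, Rpower_Ropp, Rpower_sqrt, Rpower_pow by
        first [exact Hrho | apply Rinv_0_lt_compat, Hsq]; reflexivity. }
  rewrite <- Rpower_plus.
  replace (- nu + - (3 / 2)) with (- s) by (unfold s; ring).
  rewrite Rpower_mult_distr; [|exact Hrho|generalize (pow2_ge_0 q); nra].
  f_equal; rewrite Rmult_plus_distr_l, <- Rmult_assoc, Hqq; ring.
Qed.

Lemma ray_integral_lim (nu rho a w kappa : R) :
  0 < nu -> 0 < rho -> - (PI / 2) < a < PI / 2 -> - (PI / 2) < w < PI / 2 ->
  is_lim (fun U => RInt (ray_integrand (nu + 3 / 2) (rho * cos a) (rho * sin a) kappa w) 0 U)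
    p_infty
    (cos (kappa - nu * a) * Rpower rho (- nu)
       * (Gamma (3 / 2) * Gamma nu / Gamma (nu + 3 / 2))).
Proof.
  intros Hnu Hrho Ha Hw.
  assert (Hca : 0 < cos a) by (apply cos_gt_0; lra).
  set (l := _ * _ * _).
  set (I := fun t U => RInt (ray_integrand (nu + 3 / 2) (rho * cos a) (rho * sin a) kappa t) 0 U).
  apply (is_lim_ext (fun U => (I w U - I a U) + I a U)); [intros U; unfold I; ring|].
  replace (Finite l) with (Finite (0 + l)) by (f_equal; ring).
  apply is_lim_plus'.
  - unfold I; apply (ray_integral_rotation (nu + 3 / 2) (rho * cos a) (rho * sin a) kappa a w
      (Rmax (Rabs a) (Rabs w))); [lra | apply Rmult_lt_0_compat; assumption | | |].
    + apply Rmax_lub_lt; apply Rabs_def1; lra.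
    + apply Rabs_le_between, Rmax_l.
    + apply Rabs_le_between, Rmax_r.
  - set (q := / sqrt rho).
    assert (Hq : 0 < q) by (apply Rinv_0_lt_compat, sqrt_lt_R0, Hrho).
    apply (is_lim_ext_loc (fun U => cos (kappa - nu * a) * Rpower rho (- nu)
                                      * beta_integral (nu + 3 / 2) (q * U))).
    + exists 0; intros U HU; symmetry; exact (ray_integral_aligned nu rho a kappa U Hrho Ha HU).
    + apply (is_lim_scal_l (fun U => beta_integral (nu + 3 / 2) (q * U))
        (cos (kappa - nu * a) * Rpower rho (- nu)) p_infty
        (Gamma (3 / 2) * Gamma nu / Gamma (nu + 3 / 2))).
      apply (is_lim_comp (beta_integral (nu + 3 / 2)) (fun U => q * U) p_infty _ p_infty).
      * apply beta_integral_lim, Hnu.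
      * apply is_lim_spec; intros M; exists (M / q); intros x Hx.
        apply Rmult_lt_compat_l with (1 := Hq) in Hx.
        replace (q * (M / q)) with M in Hx by (field; lra); exact Hx.
      * exists 0; intros; discriminate.
Qed.

(** * The rescaled integral *)

Lemma RInt_param_limit (h : R -> R -> R) (U e0 : R) :
  0 < U -> 0 < e0 ->
  (forall u, 0 <= u <= U -> continuity_2d_pt h u 0) ->
  (forall e, 0 <= e < e0 -> ex_RInt (fun u => h u e) 0 U) ->
  forall eta : posreal, exists d : posreal, forall e, 0 <= e < d ->
    Rabs (RInt (fun u => h u e) 0 U - RInt (fun u => h u 0) 0 U) < eta.
Proof.
  intros HU He0 Hc Hex eta.
  assert (Heta' : 0 < eta / (2 * U)).
  { apply Rdiv_lt_0_compat; [apply cond_pos | lra]. }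
  destruct (uniform_continuity_2d_1d h 0 U 0 Hc (mkposreal _ Heta')) as [d Hd]; simpl in Hd.
  assert (Hm : 0 < Rmin d e0) by (apply Rmin_glb_lt; [apply cond_pos | exact He0]).
  exists (mkposreal _ Hm); simpl; intros e He.
  assert (H1 := Rmin_l d e0); assert (H2 := Rmin_r d e0); assert (Hd0 := cond_pos d).
  rewrite <- (RInt_minus (V := R_CompleteNormedModule)) by (apply Hex; lra).
  apply Rle_lt_trans with ((U - 0) * (eta / (2 * U))).
  - apply abs_RInt_le_const; [lra | |].
    + apply (ex_RInt_minus (V := R_NormedModule)); apply Hex; lra.
    + intros u Hu; apply Rlt_le, Hd; try lra.
      rewrite Rminus_diag, Rabs_R0; exact Hd0.
  - assert (He1 := cond_pos eta).
    replace ((U - 0) * (eta / (2 * U))) with (eta / 2) by (field; lra); lra.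
Qed.

Definition sinc (t : R) : R := if Req_EM_T t 0 then 1 else sin t / t.

Lemma sinc_0 : sinc 0 = 1.
Proof. unfold sinc; destruct (Req_EM_T 0 0); [reflexivity | contradiction]. Qed.

Lemma sinc_mult (t : R) : t * sinc t = sin t.
Proof.
  unfold sinc; destruct (Req_EM_T t 0) as [->|H]; [rewrite sin_0; ring | field; exact H].
Qed.

Lemma sinc_continuous_0 : continuous sinc 0.
Proof.
  apply filterlim_locally; intros eps; rewrite sinc_0.
  destruct (derivable_pt_lim_sin_0 eps (cond_pos eps)) as [d Hd].
  exists d; intros t Ht; change (Rabs (t - 0) < d) in Ht; rewrite Rminus_0_r in Ht.
  change (Rabs (sinc t - 1) < eps).
  unfold sinc; destruct (Req_EM_T t 0) as [->|H].
  - rewrite Rminus_diag, Rabs_R0; apply cond_pos.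
  - generalize (Hd t H Ht); rewrite Rplus_0_l, sin_0, Rminus_0_r; auto.
Qed.

(** Up to PI/3 the function sin t - t/2 increases; beyond, sin t >= sin (PI/3) >= 1/2. *)
Lemma sin_ge_quarter (t : R) : 0 <= t <= PI / 2 -> t / 4 <= sin t.
Proof.
  intros Ht; assert (Hpi := PI_RGT_0); assert (Hpi4 := PI_4).
  destruct (Rle_dec t (PI / 3)) as [H|H].
  - assert (H1 : t / 2 - 0 / 2 <= sin t - sin 0).
    { apply (increment_le (fun t => t / 2) sin (fun _ => / 2) cos); [lra | | |].
      - intros x Hx; auto_derive; [exact I | field].
      - intros x Hx; auto_derive; [exact I | ring].
      - intros x Hx; replace (/ 2) with (cos (PI / 3)) by (rewrite cos_PI3; field).
        apply cos_decr_1; lra. }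
    rewrite sin_0 in H1; lra.
  - apply Rle_trans with (sin (PI / 3)); [|apply sin_incr_1; lra].
    rewrite sin_PI3.
    assert (1 <= sqrt 3) by (rewrite <- sqrt_1 at 1; apply sqrt_le_1_alt; lra); lra.
Qed.

(** Properties of the section F of the eigenfunction by the equator, near the edge
    phi = 2 PI of the cut. *)
Record edge_profile (F : R -> R) (beta : R) : Prop := {
  edge_continuous : forall phi, continuous F phi;
  edge_bounded : forall phi, 3 * PI / 2 <= phi < 2 * PI -> Rabs (F phi) <= 1;
  edge_beta_neq0 : beta <> 0;
  edge_asymptotic : filterlim (fun psi => F (2 * PI - psi) / (beta * sqrt psi))
    (at_right 0) (locally 1)
}.

(** F (2 PI - psi) / sqrt psi, extended by its limit so as to be continuous at 0. *)
Definition edge_ratio (F : R -> R) (beta psi : R) : R :=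
  if Rle_dec psi 0 then beta else F (2 * PI - psi) / sqrt psi.

Lemma edge_ratio_continuous_0 (F : R -> R) (beta : R) :
  edge_profile F beta -> continuous (edge_ratio F beta) 0.
Proof.
  intros HF; assert (Hb := edge_beta_neq0 _ _ HF).
  assert (Hab : 0 < Rabs beta) by (apply Rabs_pos_lt, Hb).
  assert (H0 : edge_ratio F beta 0 = beta).
  { unfold edge_ratio; destruct (Rle_dec 0 0); lra. }
  apply filterlim_locally; intros eps; rewrite H0.
  assert (He : 0 < eps / Rabs beta) by (apply Rdiv_lt_0_compat; [apply cond_pos | exact Hab]).
  destruct (proj1 (filterlim_locally _ _) (edge_asymptotic _ _ HF) (mkposreal _ He)) as [d Hd].
  exists d; intros psi Hpsi; change (Rabs (edge_ratio F beta psi - beta) < eps).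
  unfold edge_ratio; destruct (Rle_dec psi 0) as [H|H].
  - rewrite Rminus_diag, Rabs_R0; apply cond_pos.
  - assert (Hp : 0 < psi) by lra.
    assert (Hs : 0 < sqrt psi) by (apply sqrt_lt_R0, Hp).
    assert (H1 : Rabs (F (2 * PI - psi) / (beta * sqrt psi) - 1) < eps / Rabs beta)
      by exact (Hd psi Hpsi Hp).
    replace (F (2 * PI - psi) / sqrt psi - beta)
      with (beta * (F (2 * PI - psi) / (beta * sqrt psi) - 1)) by (field; lra).
    rewrite Rabs_mult.
    replace (pos eps) with (Rabs beta * (eps / Rabs beta)) by (field; lra).
    apply Rmult_lt_compat_l; assumption.
Qed.

Lemma edge_ratio_bounded (F : R -> R) (beta : R) :
  edge_profile F beta ->
  exists C, 0 < C /\ forall psi, 0 < psi <= PI / 2 -> Rabs (edge_ratio F beta psi) <= C.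
Proof.
  intros HF.
  destruct (proj1 (filterlim_locally _ _) (edge_ratio_continuous_0 F beta HF)
    (mkposreal 1 Rlt_0_1)) as [d Hd].
  assert (Hd0 := cond_pos d).
  assert (Hsd : 0 < sqrt d) by (apply sqrt_lt_R0, Hd0).
  assert (Hisd : 0 < / sqrt d) by (apply Rinv_0_lt_compat, Hsd).
  assert (Hab := Rabs_pos beta).
  exists (Rabs beta + 1 + / sqrt d); split; [lra|]; intros psi Hpsi.
  destruct (Rlt_dec psi d) as [H|H].
  - assert (H1 : Rabs (edge_ratio F beta psi - edge_ratio F beta 0) < 1).
    { apply Hd; change (Rabs (psi - 0) < d); rewrite Rminus_0_r, Rabs_pos_eq; lra. }
    replace (edge_ratio F beta 0) with beta in H1
      by (unfold edge_ratio; destruct (Rle_dec 0 0); lra).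
    assert (H2 := Rabs_triang (edge_ratio F beta psi - beta) beta).
    replace (edge_ratio F beta psi - beta + beta) with (edge_ratio F beta psi) in H2 by ring.
    lra.
  - assert (Hs : sqrt d <= sqrt psi) by (apply sqrt_le_1_alt; lra).
    unfold edge_ratio; destruct (Rle_dec psi 0) as [H1|H1]; [lra|].
    unfold Rdiv; rewrite Rabs_mult, Rabs_inv, (Rabs_pos_eq (sqrt psi)) by lra.
    apply Rle_trans with (1 * / sqrt d); [|lra].
    apply Rmult_le_compat.
    + apply Rabs_pos.
    + apply Rlt_le, Rinv_0_lt_compat; lra.
    + apply (edge_bounded _ _ HF); lra.
    + apply Rinv_le_contravar; assumption.
Qed.

(** Real and imaginary parts of -i (alpha1 cos phi + alpha2 sin phi + i eps) for
    alpha1 = p + i q and alpha2 = r e^(i (w - PI/2)). *)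
Definition phase_re (eps q w r phi : R) : R := eps + q * cos phi - r * cos w * sin phi.
Definition phase_im (p w r phi : R) : R := - p * cos phi - r * sin w * sin phi.

(** The integrand r^(3/2) F(phi) Re (e^(i kappa) z^(-s)) d(phi) in the variable u, with
    phi = 2 PI - u^2 / r and e = r^(-1/2).  It extends continuously to e = 0. *)
Definition rescaled_integrand (F : R -> R) (beta eps p q w s kappa u e : R) : R :=
  let psi := e ^ 2 * u ^ 2 in
  2 * u ^ 2 * edge_ratio F beta psi *
    kernel s kappa (eps + q * cos psi + u ^ 2 * sinc psi * cos w)
                   (- p * cos psi + u ^ 2 * sinc psi * sin w).

Lemma rescaled_integrand_0 (F : R -> R) (beta eps p q w s kappa u : R) :
  rescaled_integrand F beta eps p q w s kappa u 0 =
  beta * ray_integrand s (eps + q) (- p) (kappa - 3 * w / 2) w u.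
Proof.
  unfold rescaled_integrand, ray_integrand.
  replace (0 ^ 2 * u ^ 2) with 0 by ring.
  rewrite sinc_0, cos_0.
  unfold edge_ratio; destruct (Rle_dec 0 0); [|lra].
  replace (kappa - 3 * w / 2 + 3 * w / 2) with kappa by ring.
  rewrite !Rmult_1_r; ring.
Qed.

Lemma rescaled_integrand_continuous_2d (F : R -> R) (beta eps p q w s kappa u : R) :
  edge_profile F beta -> 0 < eps + q -> - (PI / 2) < w < PI / 2 ->
  continuity_2d_pt (rescaled_integrand F beta eps p q w s kappa) u 0.
Proof.
  intros HF Hq Hw; unfold rescaled_integrand.
  assert (Hpsi : continuity_2d_pt (fun u e => e ^ 2 * u ^ 2) u 0).
  { unfold pow; continuity_2d. }
  assert (Hu : continuity_2d_pt (fun u _ => u ^ 2) u 0) by (unfold pow; continuity_2d).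
  assert (H0 : 0 ^ 2 * u ^ 2 = 0) by ring.
  assert (Hcos : continuity_2d_pt (fun u e => cos (e ^ 2 * u ^ 2)) u 0).
  { apply (continuous_2d_comp cos (fun u e => e ^ 2 * u ^ 2)); [apply continuous_cos | exact Hpsi]. }
  assert (Hsinc : continuity_2d_pt (fun u e => sinc (e ^ 2 * u ^ 2)) u 0).
  { apply (continuous_2d_comp sinc (fun u e => e ^ 2 * u ^ 2)); [|exact Hpsi].
    rewrite H0; apply sinc_continuous_0. }
  assert (Her : continuity_2d_pt (fun u e => edge_ratio F beta (e ^ 2 * u ^ 2)) u 0).
  { apply (continuous_2d_comp (edge_ratio F beta) (fun u e => e ^ 2 * u ^ 2)); [|exact Hpsi].
    rewrite H0; apply edge_ratio_continuous_0, HF. }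
  apply continuity_2d_pt_mult; [continuity_2d|].
  apply (kernel_continuity_2d s (fun _ _ => kappa)
    (fun u e => eps + q * cos (e ^ 2 * u ^ 2) + u ^ 2 * sinc (e ^ 2 * u ^ 2) * cos w)
    (fun u e => - p * cos (e ^ 2 * u ^ 2) + u ^ 2 * sinc (e ^ 2 * u ^ 2) * sin w)).
  - rewrite H0, sinc_0, cos_0.
    assert (Hc : 0 < cos w) by (apply cos_gt_0; lra).
    generalize (pow2_ge_0 u); nra.
  - continuity_2d.
  - continuity_2d.
  - continuity_2d.
Qed.

Lemma phase_re_pos (eps q w r phi : R) :
  0 < eps -> 0 < eps + q -> - (PI / 2) < w < PI / 2 -> 0 < r ->
  3 * PI / 2 <= phi <= 2 * PI -> 0 < phase_re eps q w r phi.
Proof.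
  intros He Hq Hw Hr Hphi.
  assert (Hc : 0 < cos w) by (apply cos_gt_0; lra).
  assert (Hs : sin phi <= 0) by (apply sin_le_0; lra).
  assert (Hc0 : 0 <= cos phi) by (apply cos_ge_0_3PI2; lra).
  assert (Hc1 := COS_bound phi).
  unfold phase_re.
  assert (0 <= - (r * cos w * sin phi)).
  { rewrite Ropp_mult_distr_r; apply Rmult_le_pos; [apply Rmult_le_pos|]; lra. }
  destruct (Rle_dec 0 q); nra.
Qed.

Lemma equatorial_integrand_continuous (F : R -> R) (beta eps p q w s kappa r phi : R) :
  edge_profile F beta -> 0 < eps -> 0 < eps + q -> - (PI / 2) < w < PI / 2 -> 0 < r ->
  3 * PI / 2 <= phi <= 2 * PI ->
  continuous (fun phi => F phi * kernel s kappa (phase_re eps q w r phi) (phase_im p w r phi)) phi.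
Proof.
  intros HF He Hq Hw Hr Hphi.
  apply (continuous_mult F
    (fun phi => kernel s kappa (phase_re eps q w r phi) (phase_im p w r phi))).
  - apply (edge_continuous _ _ HF).
  - apply @ex_derive_continuous; eexists.
    apply (kernel_derive s (fun _ => kappa) (phase_re eps q w r) (phase_im p w r) phi 0
      (- q * sin phi - r * cos w * cos phi) (p * sin phi - r * sin w * cos phi)).
    + apply phase_re_pos; assumption.
    + apply @is_derive_const.
    + unfold phase_re; auto_derive; [exact I | ring].
    + unfold phase_im; auto_derive; [exact I | ring].
Qed.

(** Substitution phi = 2 PI - u^2 / r. *)
Lemma rescaled_integral (F : R -> R) (beta eps p q w s kappa r : R) :
  edge_profile F beta -> 0 < eps -> 0 < eps + q -> - (PI / 2) < w < PI / 2 -> 0 < r ->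
  is_RInt (fun u => rescaled_integrand F beta eps p q w s kappa u (/ sqrt r))
    0 (sqrt (PI / 2 * r))
    (Rpower r (3 / 2) *
     RInt (fun phi => F phi * kernel s kappa (phase_re eps q w r phi) (phase_im p w r phi))
       (3 * PI / 2) (2 * PI)).
Proof.
  intros HF He Hq Hw Hr; assert (Hpi := PI_RGT_0).
  set (K := fun phi => F phi * kernel s kappa (phase_re eps q w r phi) (phase_im p w r phi)).
  set (V := sqrt (PI / 2 * r)).
  assert (HV : 0 < V) by (apply sqrt_lt_R0; nra).
  assert (HVV : V ^ 2 = PI / 2 * r) by (apply pow2_sqrt; nra).
  assert (Hsr : 0 < sqrt r) by (apply sqrt_lt_R0, Hr).
  assert (Hcomp : is_RInt (fun u => scal (- (2 * u / r)) (K (2 * PI - u ^ 2 / r))) 0 V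
            (RInt K (2 * PI) (3 * PI / 2))).
  { assert (Ha : 2 * PI - 0 ^ 2 / r = 2 * PI) by (field; lra).
    assert (Hb : 2 * PI - V ^ 2 / r = 3 * PI / 2) by (rewrite HVV; field; lra).
    rewrite <- Hb, <- (f_equal (fun a => RInt K a (2 * PI - V ^ 2 / r)) Ha).
    apply (is_RInt_comp K (fun u => 2 * PI - u ^ 2 / r) (fun u => - (2 * u / r)) 0 V).
    - rewrite Rmin_left, Rmax_right by lra; intros u Hu.
      apply (equatorial_integrand_continuous F beta); try assumption.
      assert (Hur : 0 <= u ^ 2 / r <= PI / 2); [|lra].
      split.
      + apply Rmult_le_pos; [apply pow2_ge_0 | apply Rlt_le, Rinv_0_lt_compat, Hr].
      + apply Rmult_le_reg_r with r; [exact Hr|]; rewrite <- HVV.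
        replace (u ^ 2 / r * r) with (u ^ 2) by (field; lra); nra.
    - intros u _; split.
      + auto_derive; [exact I | field; lra].
      + apply @ex_derive_continuous; auto_derive; exact I. }
  assert (Hopp : opp (RInt K (2 * PI) (3 * PI / 2)) = RInt K (3 * PI / 2) (2 * PI)).
  { apply (opp_RInt_swap (V := R_CompleteNormedModule)).
    apply (ex_RInt_continuous (V := R_CompleteNormedModule)).
    rewrite Rmin_right, Rmax_left by lra; intros phi Hphi.
    apply (equatorial_integrand_continuous F beta); assumption. }
  rewrite <- Hopp.
  apply is_RInt_ext with (fun u => scal (Rpower r (3 / 2))
    (opp (scal (- (2 * u / r)) (K (2 * PI - u ^ 2 / r))))).
  - rewrite Rmin_left, Rmax_right by lra; intros u Hu.
    unfold scal, opp; simpl; unfold mult; simpl.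
    unfold K, rescaled_integrand.
    assert (Hpsi : (/ sqrt r) ^ 2 * u ^ 2 = u ^ 2 / r).
    { rewrite pow_inv, pow2_sqrt by lra; field; lra. }
    rewrite Hpsi.
    set (psi := u ^ 2 / r).
    assert (Hp0 : 0 < psi) by (apply Rdiv_lt_0_compat; [apply pow_lt|]; lra).
    assert (Hsp : sqrt psi = u / sqrt r).
    { unfold psi; rewrite sqrt_div_alt, sqrt_pow2; lra. }
    assert (Hsinc : u ^ 2 * sinc psi = r * sin psi).
    { rewrite <- sinc_mult; unfold psi; field; lra. }
    unfold edge_ratio; destruct (Rle_dec psi 0) as [H|_]; [lra|].
    change (2 * PI - u * (u * 1) / r) with (2 * PI - psi).
    replace (phase_re eps q w r (2 * PI - psi))
      with (eps + q * cos psi + u ^ 2 * sinc psi * cos w)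
      by (unfold phase_re; rewrite cos_minus, sin_minus, cos_2PI, sin_2PI, Hsinc; ring).
    replace (phase_im p w r (2 * PI - psi))
      with (- p * cos psi + u ^ 2 * sinc psi * sin w)
      by (unfold phase_im; rewrite cos_minus, sin_minus, cos_2PI, sin_2PI, Hsinc; ring).
    replace (Rpower r (3 / 2)) with (r * sqrt r).
    2:{ replace (3 / 2) with (1 + / 2) by field.
        rewrite Rpower_plus, Rpower_1, Rpower_sqrt; auto. }
    rewrite Hsp; field; lra.
  - apply (is_RInt_scal (V := R_NormedModule)), (is_RInt_opp (V := R_NormedModule)), Hcomp.
Qed.

(** On the range of integration sin psi >= psi / 4, so that |z| >= u^2 cos w / 4
    uniformly in r. *)
Lemma rescaled_tail (F : R -> R) (beta eps p q w nu kappa : R) :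
  edge_profile F beta -> 0 < nu -> 0 < eps -> 0 < eps + q -> - (PI / 2) < w < PI / 2 ->
  exists C, forall r U, 0 < r -> 0 < U <= sqrt (PI / 2 * r) ->
    Rabs (RInt (fun u => rescaled_integrand F beta eps p q w (nu + 3 / 2) kappa u (/ sqrt r))
            U (sqrt (PI / 2 * r)))
      <= C * Rpower U (- (2 * nu)).
Proof.
  intros HF Hnu He Hq Hw; assert (Hpi := PI_RGT_0).
  set (s := nu + 3 / 2).
  destruct (edge_ratio_bounded F beta HF) as (C0 & HC0 & HC).
  assert (Hc : 0 < cos w) by (apply cos_gt_0; lra).
  set (K := 2 * C0 * Rpower (cos w / 4) (- s)).
  assert (HK : 0 < K) by (apply Rmult_lt_0_compat; [lra | apply exp_pos]).
  exists (K / (2 * nu)); intros r U Hr HU.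
  set (V := sqrt (PI / 2 * r)) in *.
  assert (HVV : V ^ 2 = PI / 2 * r) by (apply pow2_sqrt; nra).
  assert (Hsr : 0 < sqrt r) by (apply sqrt_lt_R0, Hr).
  set (h := fun u => rescaled_integrand F beta eps p q w s kappa u (/ sqrt r)).
  assert (Hexh : ex_RInt h U V).
  { apply (ex_RInt_Chasles_2 h 0); [lra|].
    eexists; apply (rescaled_integral F beta eps p q w s kappa r); assumption. }
  set (G := fun u => - (K / (2 * nu)) * Rpower u (- (2 * nu))).
  assert (HG : is_RInt (fun u => K * Rpower u (- (2 * nu) - 1)) U V (G V - G U)).
  { apply (is_RInt_derive G).
    - rewrite Rmin_left, Rmax_right by lra; intros u Hu; unfold G.
      replace (K * Rpower u (- (2 * nu) - 1)) with
        (- (K / (2 * nu)) * (- (2 * nu) * Rpower u (- (2 * nu) - 1))) by (field; lra).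
      apply (is_derive_scal (fun u => Rpower u (- (2 * nu)))), is_derive_Rpower; lra.
    - rewrite Rmin_left, Rmax_right by lra; intros u Hu.
      apply (continuous_mult (fun _ => K) (fun u => Rpower u (- (2 * nu) - 1))).
      + apply continuous_const.
      + apply continuous_Rpower; lra. }
  apply Rle_trans with (RInt (fun u => K * Rpower u (- (2 * nu) - 1)) U V).
  - apply (abs_RInt_le h) in Hexh as Habs; [|lra].
    apply Rle_trans with (1 := Habs).
    apply RInt_le; [lra | | eexists; exact HG |].
    + apply (ex_RInt_norm h), Hexh.
    + intros u Hu.
      unfold h, rescaled_integrand.
      assert (Hu2 : 0 < u ^ 2) by (apply pow_lt; lra).
      replace ((/ sqrt r) ^ 2 * u ^ 2) with (u ^ 2 / r).
      2:{ rewrite pow_inv, pow2_sqrt by lra; field; lra. }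
      set (psi := u ^ 2 / r).
      assert (Hpsi : 0 < psi <= PI / 2).
      { split; [apply Rdiv_lt_0_compat; lra|].
        apply Rmult_le_reg_r with (1 := Hr); rewrite <- HVV.
        replace (psi * r) with (u ^ 2) by (unfold psi; field; lra); nra. }
      assert (Hsinc : / 4 <= sinc psi).
      { apply Rmult_le_reg_l with psi; [lra|].
        rewrite sinc_mult; generalize (sin_ge_quarter psi ltac:(lra)); lra. }
      assert (Hx : cos w / 4 * u ^ 2 <= eps + q * cos psi + u ^ 2 * sinc psi * cos w).
      { assert (H1 : 0 <= cos psi) by (apply cos_ge_0; lra).
        assert (H2 := COS_bound psi).
        assert (H3 : 0 <= eps + q * cos psi) by (destruct (Rle_dec 0 q); nra).
        assert (H4 : u ^ 2 * cos w * / 4 <= u ^ 2 * cos w * sinc psi).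
        { apply Rmult_le_compat_l; [|exact Hsinc].
          apply Rlt_le, Rmult_lt_0_compat; assumption. }
        lra. }
      assert (Hcu : 0 < cos w / 4 * u ^ 2) by (apply Rmult_lt_0_compat; lra).
      rewrite !Rabs_mult, (Rabs_pos_eq 2), (Rabs_pos_eq (u ^ 2)) by lra.
      apply Rle_trans with (2 * u ^ 2 * C0 * Rpower (cos w / 4 * u ^ 2) (- s)).
      * apply Rmult_le_compat.
        -- apply Rmult_le_pos; [lra | apply Rabs_pos].
        -- apply Rabs_pos.
        -- apply Rmult_le_compat_l; [lra | apply HC, Hpsi].
        -- apply Rle_trans with
             (Rpower (eps + q * cos psi + u ^ 2 * sinc psi * cos w) (- s)).
           ++ apply kernel_bound; unfold s; lra.
           ++ rewrite 2!Rpower_Ropp; apply Rinv_le_contravar; [apply exp_pos|].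
              apply Rle_Rpower_l; [unfold s; lra | split; assumption].
      * right; rewrite <- Rpower_mult_distr by lra.
        unfold K.
        replace (- (2 * nu) - 1) with (INR 2 + INR 2 * - s) by (unfold s; simpl; field).
        rewrite Rpower_plus, <- Rpower_mult, !Rpower_pow by lra; ring.
  - rewrite (is_RInt_unique _ _ _ _ HG); unfold G.
    assert (0 < Rpower V (- (2 * nu))) by apply exp_pos.
    assert (0 < K / (2 * nu)) by (apply Rdiv_lt_0_compat; lra).
    nra.
Qed.

(** The cut-off U is chosen first, so that the tails of both integrals are small
    uniformly in r; on (0, U) the integrands converge uniformly. *)
Lemma equatorial_integral_lim (F : R -> R) (beta eps p q w nu kappa rho a : R) :
  edge_profile F beta -> 0 < nu -> 0 < eps ->
  0 < rho -> - (PI / 2) < a < PI / 2 -> - (PI / 2) < w < PI / 2 ->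
  eps + q = rho * cos a -> - p = rho * sin a ->
  is_lim (fun r => Rpower r (3 / 2) *
     RInt (fun phi => F phi * kernel (nu + 3 / 2) kappa
                                (phase_re eps q w r phi) (phase_im p w r phi))
       (3 * PI / 2) (2 * PI)) p_infty
    (beta * (cos (kappa - 3 * w / 2 - nu * a) * Rpower rho (- nu)
       * (Gamma (3 / 2) * Gamma nu / Gamma (nu + 3 / 2)))).
Proof.
  intros HF Hnu He Hrho Ha Hw Hre Him; assert (Hpi := PI_RGT_0).
  assert (Hca : 0 < cos a) by (apply cos_gt_0; lra).
  assert (Hq : 0 < eps + q) by (rewrite Hre; nra).
  set (s := nu + 3 / 2).
  assert (Hray := ray_integral_lim nu rho a w (kappa - 3 * w / 2) Hnu Hrho Ha Hw).
  rewrite <- Hre, <- Him in Hray; fold s in Hray.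
  set (L := cos _ * _ * _) in *.
  set (h := rescaled_integrand F beta eps p q w s kappa).
  destruct (rescaled_tail F beta eps p q w nu kappa HF Hnu He Hq Hw) as (C & HC).
  fold s in HC.
  assert (Hresc := fun r Hr => rescaled_integral F beta eps p q w s kappa r HF He Hq Hw Hr).
  fold h in Hresc, HC.
  assert (Hexray : forall U, ex_RInt (ray_integrand s (eps + q) (- p) (kappa - 3 * w / 2) w) 0 U).
  { intros U; apply (ex_RInt_continuous (V := R_CompleteNormedModule)); intros u _.
    apply ray_integrand_continuous; assumption. }
  apply is_lim_spec; intros eta.
  assert (Heta := cond_pos eta).
  assert (Hab : 0 < Rabs beta) by (apply Rabs_pos_lt, (edge_beta_neq0 _ _ HF)).
  (* the cut-off U, from the limit of the ray integral and the tail estimate *)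
  assert (HU : exists U, 0 < U /\
    Rabs (RInt (ray_integrand s (eps + q) (- p) (kappa - 3 * w / 2) w) 0 U - L)
      < eta / 3 / Rabs beta /\ C * Rpower U (- (2 * nu)) < eta / 3).
  { assert (He1 : 0 < eta / 3 / Rabs beta) by (apply Rdiv_lt_0_compat; lra).
    assert (He2 : 0 < eta / 3) by lra.
    assert (Hpow : is_lim (fun U => C * Rpower U (- (2 * nu))) p_infty 0).
    { replace (Finite 0) with (Rbar_mult C 0) by (simpl; f_equal; ring).
      apply is_lim_scal_l, is_lim_Rpower_neg; lra. }
    apply is_lim_spec in Hray; destruct (Hray (mkposreal _ He1)) as [U1 HU1].
    apply is_lim_spec in Hpow; destruct (Hpow (mkposreal _ He2)) as [U2 HU2].
    simpl in HU1, HU2.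
    assert (H1 := Rmax_l 0 (Rmax U1 U2)); assert (H2 := Rmax_r 0 (Rmax U1 U2)).
    assert (H3 := Rmax_l U1 U2); assert (H4 := Rmax_r U1 U2).
    exists (Rmax 0 (Rmax U1 U2) + 1); split; [lra|]; split.
    - apply HU1; lra.
    - specialize (HU2 (Rmax 0 (Rmax U1 U2) + 1) ltac:(lra)).
      rewrite Rminus_0_r in HU2; apply Rabs_def2 in HU2; lra. }
  destruct HU as (U & HU0 & HU1 & HU2).
  assert (HexU : forall r, 0 < r -> U <= sqrt (PI / 2 * r) ->
            ex_RInt (fun u => h u (/ sqrt r)) 0 U).
  { intros r Hr HUr; apply (ex_RInt_Chasles_1 (fun u => h u (/ sqrt r)) 0 U (sqrt (PI / 2 * r))).
    - lra.
    - eexists; apply Hresc, Hr. }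
  (* for r^(-1/2) < 1 / U the cut-off lies in the range of integration *)
  assert (Hsqrt : forall r, 0 < r -> sqrt r <= sqrt (PI / 2 * r)).
  { intros r Hr; apply sqrt_le_1_alt; generalize PI2_1; nra. }
  assert (Hh0 : forall u, beta * ray_integrand s (eps + q) (- p) (kappa - 3 * w / 2) w u = h u 0).
  { intros u; apply eq_sym, rescaled_integrand_0. }
  assert (HiU : 0 < / U) by (apply Rinv_0_lt_compat, HU0).
  assert (Heta3 : 0 < eta / 3) by lra.
  assert (Hlim := fun H1 H2 =>
    RInt_param_limit h U (/ U) HU0 HiU H1 H2 (mkposreal _ Heta3)).
  destruct Hlim as [d Hd].
  { intros u _; apply rescaled_integrand_continuous_2d; assumption. }
  { intros e Hee; destruct (Req_dec e 0) as [->|Hne].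
    - apply ex_RInt_ext with (fun u => scal beta
        (ray_integrand s (eps + q) (- p) (kappa - 3 * w / 2) w u)).
      + intros u _; apply Hh0.
      + apply (ex_RInt_scal (V := R_NormedModule)), Hexray.
    - assert (Hs : sqrt ((/ e) ^ 2) = / e).
      { apply sqrt_pow2, Rlt_le, Rinv_0_lt_compat; lra. }
      assert (Hie : U <= / e).
      { rewrite <- (Rinv_inv U); apply Rinv_le_contravar; lra. }
      assert (Hr : 0 < (/ e) ^ 2) by (apply pow_lt, Rinv_0_lt_compat; lra).
      replace e with (/ sqrt ((/ e) ^ 2)) by (rewrite Hs, Rinv_inv; reflexivity).
      apply HexU; [exact Hr|].
      apply Rle_trans with (2 := Hsqrt _ Hr); rewrite Hs; exact Hie. }
  simpl in Hd; assert (Hd0 := cond_pos d).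
  set (m := Rmin d (/ U)).
  assert (Hm : 0 < m) by (apply Rmin_glb_lt; assumption).
  exists ((/ m) ^ 2); intros r Hr.
  assert (Him0 : 0 < / m) by (apply Rinv_0_lt_compat, Hm).
  assert (Hr0 : 0 < r) by (generalize (pow_lt _ 2 Him0); lra).
  assert (Hsr : / m < sqrt r).
  { rewrite <- (sqrt_pow2 (/ m)) by lra; apply sqrt_lt_1_alt; split; [apply pow2_ge_0 | exact Hr]. }
  assert (Hisr : 0 < / sqrt r < m).
  { split; [apply Rinv_0_lt_compat; lra|].
    rewrite <- (Rinv_inv m); apply Rinv_lt_contravar; [apply Rmult_lt_0_compat; lra | exact Hsr]. }
  assert (Hmd : m <= d) by apply Rmin_l; assert (HmU : m <= / U) by apply Rmin_r.
  assert (HUr : U <= sqrt r).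
  { apply Rle_trans with (/ m); [|lra].
    rewrite <- (Rinv_inv U); apply Rinv_le_contravar; assumption. }
  assert (HUV : U <= sqrt (PI / 2 * r)) by (apply Rle_trans with (1 := HUr); auto).
  specialize (HC r U Hr0 (conj HU0 HUV)).
  specialize (Hd (/ sqrt r) ltac:(lra)).
  rewrite <- (is_RInt_unique _ _ _ _ (Hresc r Hr0)).
  assert (HCh := RInt_Chasles (V := R_CompleteNormedModule) (fun u => h u (/ sqrt r)) 0 U
    (sqrt (PI / 2 * r)) (HexU r Hr0 HUV)
    (ex_RInt_Chasles_2 (V := R_CompleteNormedModule) (fun u => h u (/ sqrt r)) 0 U
       (sqrt (PI / 2 * r)) (conj (Rlt_le _ _ HU0) HUV) (ex_intro _ _ (Hresc r Hr0)))).
  rewrite <- HCh; unfold plus; simpl.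
  assert (Hbeta : RInt (fun u => h u 0) 0 U =
            beta * RInt (ray_integrand s (eps + q) (- p) (kappa - 3 * w / 2) w) 0 U).
  { rewrite <- (RInt_ext _ _ 0 U (fun u _ => Hh0 u)).
    apply (RInt_scal (V := R_CompleteNormedModule)), Hexray. }
  rewrite Hbeta in Hd.
  assert (H3 : Rabs (beta * RInt (ray_integrand s (eps + q) (- p) (kappa - 3 * w / 2) w) 0 U
                     - beta * L) < eta / 3).
  { rewrite <- Rmult_minus_distr_l, Rabs_mult.
    replace (eta / 3) with (Rabs beta * (eta / 3 / Rabs beta)) by (field; lra).
    apply Rmult_lt_compat_l; assumption. }
  apply Rabs_def2 in Hd; apply Rabs_def2 in H3; apply Rabs_le_between in HC.
  apply Rabs_def1; lra.
Qed.

(** * Complex powers and the asymptotic coefficient *)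

Lemma Cexp_plus (z z' : C) : Cexp (z + z')%C = (Cexp z * Cexp z')%C.
Proof.
  destruct z as [x y], z' as [x' y']; unfold Cexp, Cplus, Cmult; simpl.
  rewrite exp_plus, cos_plus, sin_plus; f_equal; ring.
Qed.

Lemma Cexp_0 : Cexp 0 = 1.
Proof. unfold Cexp; simpl; rewrite exp_0, cos_0, sin_0; unfold RtoC; f_equal; ring. Qed.

Lemma Cexp_neq_0 (z : C) : Cexp z <> 0.
Proof.
  intros H; apply C1_nz; rewrite <- Cexp_0; replace (RtoC 0) with (z + - z)%C by ring.
  rewrite Cexp_plus, H; ring.
Qed.

Lemma Cexp_opp (z : C) : Cexp (- z) = (/ Cexp z)%C.
Proof.
  assert (H := Cexp_neq_0 z).
  assert (H1 : (Cexp z * Cexp (- z) = 1)%C).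
  { rewrite <- Cexp_plus, <- Cexp_0; f_equal; ring. }
  replace (Cexp (- z)) with (/ Cexp z * (Cexp z * Cexp (- z)))%C by (field; exact H).
  rewrite H1; ring.
Qed.

Lemma Cpow_principal_right (x y s : R) :
  0 < x ->
  Cpow_principal (x, y) s = Cexp (s / 2 * ln (x ^ 2 + y ^ 2), s * atan (y / x)).
Proof.
  intros Hx; unfold Cpow_principal, Carg, Cmod; simpl Re; simpl Im; simpl fst; simpl snd.
  destruct (Rlt_dec 0 x) as [_|H]; [|contradiction].
  f_equal; unfold RtoC, Cmult; simpl fst; simpl snd.
  assert (HN : 0 < x ^ 2 + y ^ 2).
  { generalize (pow2_ge_0 y) (pow_lt x 2 Hx); lra. }
  rewrite <- Rpower_sqrt by exact HN; unfold Rpower; rewrite ln_exp.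
  change (x * (x * 1) + y * (y * 1)) with (x ^ 2 + y ^ 2); f_equal; field.
Qed.

Lemma div_Cpow_principal (F x y s : R) :
  0 < x ->
  (RtoC F / Cpow_principal (x, y) s)%C = (F * kernel s 0 x y, F * kernel s (- (PI / 2)) x y).
Proof.
  intros Hx; rewrite Cpow_principal_right by exact Hx.
  unfold Cdiv; rewrite <- Cexp_opp; unfold kernel, Cexp, Copp, Cmult, RtoC; simpl.
  replace (0 - s * atan (y / x)) with (- (s * atan (y / x))) by ring.
  replace (- (PI / 2) - s * atan (y / x)) with (- (PI / 2 + s * atan (y / x))) by ring.
  rewrite (cos_neg (PI / 2 + _)), cos_plus, cos_PI2, sin_PI2, sin_neg.
  replace (- (s / 2) * ln (x * (x * 1) + y * (y * 1)))
    with (- (s / 2 * ln (x * (x * 1) + y * (y * 1)))) by ring.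
  f_equal; ring.
Qed.

(** Separation of the real and imaginary parts of the integral. *)
Lemma I_pm_phase (f : R -> R -> R) (beta nu eps p q r phi2 : R) :
  edge_profile (f (PI / 2)) beta -> 0 < eps -> 0 < eps + q -> - PI < phi2 < 0 -> 0 < r ->
  let J kappa := RInt (fun phi => f (PI / 2) phi * kernel (nu + 3 / 2) kappa
       (phase_re eps q (phi2 + PI / 2) r phi) (phase_im p (phi2 + PI / 2) r phi))
       (3 * PI / 2) (2 * PI) in
  I_pm f nu eps (p, q) (Cpolar r phi2) = (J 0, J (- (PI / 2))).
Proof.
  intros HF He Hq Hphi Hr J; assert (Hpi := PI_RGT_0).
  assert (Hex : forall kappa, ex_RInt (fun phi => f (PI / 2) phi * kernel (nu + 3 / 2) kappa
       (phase_re eps q (phi2 + PI / 2) r phi) (phase_im p (phi2 + PI / 2) r phi))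
       (3 * PI / 2) (2 * PI)).
  { intros kappa; apply (ex_RInt_continuous (V := R_CompleteNormedModule)).
    rewrite Rmin_left, Rmax_right by lra; intros phi Hin.
    apply (equatorial_integrand_continuous _ beta); try assumption; lra. }
  assert (Hint : forall phi, 3 * PI / 2 <= phi <= 2 * PI ->
    (RtoC (f (PI / 2)%R phi) / Cpow_principal
          (- Ci * (((p, q) : C) * RtoC (cos phi) + Cpolar r phi2 * RtoC (sin phi)
                   + Ci * RtoC eps)) (nu + 3 / 2)%R)%C =
    (f (PI / 2) phi * kernel (nu + 3 / 2) 0
       (phase_re eps q (phi2 + PI / 2) r phi) (phase_im p (phi2 + PI / 2) r phi),
     f (PI / 2) phi * kernel (nu + 3 / 2) (- (PI / 2))
       (phase_re eps q (phi2 + PI / 2) r phi) (phase_im p (phi2 + PI / 2) r phi))).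
  { intros phi Hin.
    replace (- Ci * (((p, q) : C) * RtoC (cos phi) + Cpolar r phi2 * RtoC (sin phi)
                   + Ci * RtoC eps))%C
      with ((phase_re eps q (phi2 + PI / 2) r phi, phase_im p (phi2 + PI / 2) r phi) : C).
    - apply div_Cpow_principal, phase_re_pos; lra.
    - unfold phase_re, phase_im, Cpolar, Cexp, Ci, RtoC, Cmult, Cplus, Copp; simpl.
      rewrite cos_plus, sin_plus, cos_PI2, sin_PI2.
      replace (0 * phi2 - 1 * 0) with 0 by ring.
      replace (0 * 0 + 1 * phi2) with phi2 by ring.
      rewrite exp_0; f_equal; ring. }
  apply (is_RInt_unique (V := C_R_CompleteNormedModule)).
  apply (is_RInt_fct_extend_pair (U := R_NormedModule) (V := R_NormedModule)).
  - apply is_RInt_ext with (2 := RInt_correct _ _ _ (Hex 0)).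
    rewrite Rmin_left, Rmax_right by lra; intros phi Hin; rewrite Hint; [reflexivity | lra].
  - apply is_RInt_ext with (2 := RInt_correct _ _ _ (Hex (- (PI / 2)))).
    rewrite Rmin_left, Rmax_right by lra; intros phi Hin; rewrite Hint; [reflexivity | lra].
Qed.

(** The first factor on the right is the limit of r^(3/2) I_pm, by
    equatorial_integral_lim; the second one is the phase of alpha2^(3/2). *)
Lemma Lambda2_polar (beta nu eps p q rho a w : R) :
  0 < nu -> 0 < rho -> - (PI / 2) < a < PI / 2 -> eps + q = rho * cos a -> - p = rho * sin a ->
  let K := beta * (Rpower rho (- nu) * (Gamma (3 / 2) * Gamma nu / Gamma (nu + 3 / 2))) in
  Lambda2 beta nu (p, q) eps =
  (((K * cos (0 - 3 * w / 2 - nu * a), K * cos (- (PI / 2) - 3 * w / 2 - nu * a))%R : C)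
    * Cexp (Ci * RtoC (3 * (w - PI / 2) / 2)%R))%C.
Proof.
  intros Hnu Hrho Ha Hre Him K.
  assert (Hca : 0 < cos a) by (apply cos_gt_0; lra).
  assert (HG := Gamma_pos (nu + 3 / 2) ltac:(lra)).
  assert (HG0 : RtoC (2 * Gamma (nu + 3 / 2)) <> 0%C).
  { intros H; apply RtoC_inj in H; lra. }
  unfold Lambda2.
  replace (RtoC eps - Ci * ((p, q) : C))%C with ((eps + q, - p) : C).
  2:{ unfold Ci, RtoC, Cmult, Cminus, Cplus, Copp; simpl; f_equal; ring. }
  rewrite Cpow_principal_right by (rewrite Hre; nra).
  rewrite Hre, Him.
  replace ((rho * cos a) ^ 2 + (rho * sin a) ^ 2) with (rho ^ 2).
  2:{ replace ((rho * cos a) ^ 2 + (rho * sin a) ^ 2)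
        with (rho ^ 2 * (Rsqr (sin a) + Rsqr (cos a))) by (unfold Rsqr; ring).
      rewrite sin2_cos2; ring. }
  replace (rho * sin a / (rho * cos a)) with (tan a) by (unfold tan; field; lra).
  rewrite atan_tan by lra.
  rewrite ln_pow by exact Hrho.
  replace (1 / Cexp ((nu / 2 * (INR 2 * ln rho), nu * a)%R : C))%C
    with (RtoC (Rpower rho (- nu)%R) * Cexp (- (Ci * RtoC (nu * a)%R)))%C.
  2:{ unfold Cdiv; rewrite Cmult_1_l, <- Cexp_opp.
      unfold Rpower, Cexp, Ci, RtoC, Cmult, Copp; simpl.
      replace (nu / 2 * ((1 + 1) * ln rho)) with (nu * ln rho) by field.
      replace (- (0 * (nu * a) - 1 * 0)) with 0 by ring.
      replace (- (0 * 0 + 1 * (nu * a))) with (- (nu * a)) by ring.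
      rewrite exp_0, <- Ropp_mult_distr_l; f_equal; ring. }
  replace ((K * cos (0 - 3 * w / 2 - nu * a), K * cos (- (PI / 2) - 3 * w / 2 - nu * a)) : C)
    with (RtoC K * Cexp (- (Ci * RtoC (3 * w / 2 + nu * a)%R)))%C.
  2:{ unfold Cexp, Ci, RtoC, Cmult, Copp; simpl.
      replace (- (0 * (3 * w / 2 + nu * a) - 1 * 0)) with 0 by ring.
      replace (- (0 * 0 + 1 * (3 * w / 2 + nu * a))) with (- (3 * w / 2 + nu * a)) by ring.
      replace (0 - 3 * w / 2 - nu * a) with (- (3 * w / 2 + nu * a)) by ring.
      replace (- (PI / 2) - 3 * w / 2 - nu * a) with (- (PI / 2 + (3 * w / 2 + nu * a))) by ring.
      rewrite (cos_neg (PI / 2 + _)), (cos_plus (PI / 2)), cos_PI2, sin_PI2, sin_neg, exp_0.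
      f_equal; ring. }
  replace (RtoC (beta * sqrt PI * Gamma nu)%R * Cexp (- (3 * Ci * RtoC (PI / 4)%R))
      / RtoC (2 * Gamma (nu + 3 / 2))%R
      * (RtoC (Rpower rho (- nu)%R) * Cexp (- (Ci * RtoC (nu * a)%R))))%C
    with (RtoC (beta * sqrt PI * Gamma nu)%R / RtoC (2 * Gamma (nu + 3 / 2))%R
      * RtoC (Rpower rho (- nu)%R)
      * (Cexp (- (3 * Ci * RtoC (PI / 4)%R)) * Cexp (- (Ci * RtoC (nu * a)%R))))%C
    by (field; exact HG0).
  rewrite <- RtoC_div, <- RtoC_mult, <- Cexp_plus by lra.
  rewrite <- (Cmult_assoc (RtoC K)), <- Cexp_plus.
  f_equal.
  - f_equal; unfold K; rewrite Gamma_3_2; field; lra.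
  - f_equal; unfold Ci, RtoC, Cmult, Cplus, Copp; simpl; f_equal; field.
Qed.

Lemma polar_form_right (x y : R) :
  0 < x -> exists rho a, 0 < rho /\ - (PI / 2) < a < PI / 2 /\
    x = rho * cos a /\ y = rho * sin a.
Proof.
  intros Hx; exists (x / cos (atan (y / x))), (atan (y / x)).
  assert (Ha := atan_bound (y / x)).
  assert (Hc : 0 < cos (atan (y / x))) by (apply cos_gt_0; lra).
  repeat split; try lra.
  - apply Rdiv_lt_0_compat; assumption.
  - field; lra.
  - replace (x / cos (atan (y / x)) * sin (atan (y / x))) with (x * tan (atan (y / x)))
      by (unfold tan; field; lra).
    rewrite tan_atan; field; lra.
Qed.

Lemma edge_profile_of_eigenfunction (l : R) (f : R -> R -> R) (beta : R) :
  dirichlet_eigenfunction l f -> equatorial_properties f beta ->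
  edge_profile (f (PI / 2)) beta.
Proof.
  intros Hf Heq; assert (Hpi := PI_RGT_0); split.
  - intros phi; apply filterlim_locally; intros eps.
    destruct (eigen_continuity_eps l f (PI / 2) phi eps Hf ltac:(lra)) as [d Hd].
    exists d; intros psi Hpsi; apply Hd; [lra | | exact Hpsi].
    rewrite Rminus_diag, Rabs_R0; apply cond_pos.
  - intros phi Hphi; destruct (eq_bounds _ _ Heq phi) as [H0 H1]; [lra|].
    rewrite Rabs_pos_eq; lra.
  - apply (eq_beta_neq0 _ _ Heq).
  - apply (eq_beta _ _ Heq).
Qed.

Lemma filterlim_C_pair {T : Type} (F : (T -> Prop) -> Prop) {FF : Filter F}
  (f g : T -> R) (a b : R) :
  filterlim f F (locally a) -> filterlim g F (locally b) ->
  filterlim (fun t => (f t, g t) : C) F (locally ((a, b) : C)).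
Proof.
  intros Hf Hg; apply filterlim_locally; intros eps.
  generalize (proj1 (filterlim_locally _ _) Hf eps) (proj1 (filterlim_locally _ _) Hg eps).
  intros H1 H2; generalize (filter_and _ _ H1 H2); apply filter_imp.
  intros t [H3 H4]; split; assumption.
Qed.

Theorem mainTheorem4
  (A1 A2 : R -> C) (M eps : R)
  (l1 : R) (f : R -> R -> R) (beta : R)
  (alpha1 : C) (phi2 : R)
  (hA1 : is_contour A1) (hA2 : is_contour A2)
  (hM : 0 < M)
  (hM1 : forall a : C, UHP A1 a -> - M <= Im a)
  (hM2 : forall a : C, LHP A2 a -> Im a <= M)
  (hf : first_eigenfunction l1 f)
  (hfeq : equatorial_properties f beta)
  (heps : 2 * M < eps)
  (halpha1 : UHP A1 alpha1)
  (hphi2 : - PI < phi2 < 0) :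
  filterlim
    (fun r : R =>
       (I_pm f (nu_of l1) eps alpha1 (Cpolar r phi2) /
        (Lambda2 beta (nu_of l1) alpha1 eps /
         Cpolar (Rpower r (3 / 2)) (3 * phi2 / 2)))%C)
    (within (fun r : R => LHP A2 (Cpolar r phi2)) (Rbar_locally p_infty))
    (locally (RtoC 1)).
Proof.
  assert (Hpi := PI_RGT_0).
  destruct hf as [Hf _].
  assert (HF := edge_profile_of_eigenfunction l1 f beta Hf hfeq).
  assert (Hnu : 0 < nu_of l1).
  { apply sqrt_lt_R0; cut (0 <= l1); [lra|].
    apply (eigenvalue_nonneg l1 f Hf); exists PI; split; [lra|].
    apply (eq_bounds _ _ hfeq); lra. }
  specialize (hM1 alpha1 halpha1); destruct alpha1 as [p q]; simpl in hM1.
  assert (Hq : 0 < eps + q) by lra.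
  assert (Heps : 0 < eps) by lra.
  set (nu := nu_of l1) in *.
  set (w := phi2 + PI / 2).
  assert (Hw : - (PI / 2) < w < PI / 2) by (unfold w; lra).
  destruct (polar_form_right (eps + q) (- p) Hq) as (rho & a & Hrho & Ha & Hre & Him).
  assert (HL := Lambda2_polar beta nu eps p q rho a w Hnu Hrho Ha Hre Him); cbv zeta in HL.
  replace (w - PI / 2) with phi2 in HL by (unfold w; ring).
  set (K := beta * _) in HL.
  set (l := (K * cos _, K * cos _)%R : C) in HL.
  set (E := Cexp (Ci * RtoC (3 * phi2 / 2)%R)) in HL.
  set (Lam := Lambda2 beta nu (p, q) eps) in *.
  assert (HE : E <> 0) by apply Cexp_neq_0.
  assert (HK : K <> 0).
  { assert (H1 := Gamma_pos nu Hnu); assert (H2 := Gamma_pos (nu + 3 / 2) ltac:(lra)).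
    assert (H3 := Gamma_pos (3 / 2) ltac:(lra)).
    assert (H4 : 0 < Rpower rho (- nu)) by apply exp_pos.
    apply Rmult_integral_contrapositive_currified; [apply (eq_beta_neq0 _ _ hfeq)|].
    apply Rgt_not_eq, Rmult_lt_0_compat; [exact H4|].
    apply Rdiv_lt_0_compat; [apply Rmult_lt_0_compat|]; assumption. }
  assert (Hl : l <> 0).
  { intros H; injection H; intros H2 H1.
    set (t := 3 * w / 2 + nu * a).
    replace (0 - 3 * w / 2 - nu * a) with (- t) in H1 by (unfold t; ring).
    replace (- (PI / 2) - 3 * w / 2 - nu * a) with (- (PI / 2 + t)) in H2 by (unfold t; ring).
    rewrite cos_neg in H1, H2; rewrite cos_plus, cos_PI2, sin_PI2 in H2.
    assert (H3 := sin2_cos2 t); unfold Rsqr in H3.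
    apply Rmult_integral in H1; destruct H1 as [H1|H1]; [contradiction|].
    apply Rmult_integral in H2; destruct H2 as [H2|H2]; [contradiction|].
    nra. }
  set (J := fun kappa r => Rpower r (3 / 2) *
    RInt (fun phi => f (PI / 2) phi * kernel (nu + 3 / 2) kappa
       (phase_re eps q w r phi) (phase_im p w r phi)) (3 * PI / 2) (2 * PI)).
  assert (HJ : forall kappa, is_lim (J kappa) p_infty (K * cos (kappa - 3 * w / 2 - nu * a))).
  { intros kappa.
    replace (K * cos (kappa - 3 * w / 2 - nu * a)) with
      (beta * (cos (kappa - 3 * w / 2 - nu * a) * Rpower rho (- nu)
        * (Gamma (3 / 2) * Gamma nu / Gamma (nu + 3 / 2)))) by (unfold K; ring).
    apply equatorial_integral_lim; assumption. }
  set (c := (E / Lam)%C).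
  assert (Hc : (l * c = 1)%C).
  { unfold c; rewrite HL; field; split; assumption. }
  eapply filterlim_filter_le_1; [apply filter_le_within|].
  apply filterlim_ext_loc with (fun r => (((J 0 r, J (- (PI / 2)) r)%R : C) * c)%C).
  - exists 0; intros r Hr.
    rewrite (I_pm_phase f beta nu eps p q r phi2 HF Heps Hq hphi2 Hr); cbv zeta; fold w.
    assert (HP : RtoC (Rpower r (3 / 2)) <> 0).
    { intros H; apply RtoC_inj in H; generalize (exp_pos (3 / 2 * ln r)).
      unfold Rpower in H; lra. }
    unfold Cpolar; fold E.
    replace ((J 0 r, J (- (PI / 2)) r) : C) with
      (RtoC (Rpower r (3 / 2)%R) * ((RInt (fun phi => f (PI / 2) phi * kernel (nu + 3 / 2) 0
         (phase_re eps q w r phi) (phase_im p w r phi)) (3 * PI / 2) (2 * PI),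
        RInt (fun phi => f (PI / 2) phi * kernel (nu + 3 / 2) (- (PI / 2))
         (phase_re eps q w r phi) (phase_im p w r phi)) (3 * PI / 2) (2 * PI))%R : C))%C.
    + unfold c; rewrite HL; field; repeat split; assumption.
    + unfold J, RtoC, Cmult; simpl; f_equal; ring.
  - rewrite <- Hc; destruct c as [c1 c2]; unfold Cmult; simpl fst; simpl snd.
    assert (Hs : forall kappa k, is_lim (fun r => J kappa r * k) p_infty
              (K * cos (kappa - 3 * w / 2 - nu * a) * k)).
    { intros kappa k; apply (is_lim_scal_r (J kappa) k p_infty (Finite _) (HJ kappa)). }
    apply (filterlim_C_pair (Rbar_locally p_infty)).
    + apply (is_lim_minus' _ _ p_infty _ _ (Hs _ _) (Hs _ _)).
    + apply (is_lim_plus' _ _ p_infty _ _ (Hs _ _) (Hs _ _)).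
Qed.
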